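(* Let $d,r\ge2$ and $e\ge1$. The braid group $B(\infty,\infty,r)$ is translation discrete, and the braid group $B(de,e,r)$ is strongly translation discrete.
   Context: For $d,r\ge 2$, $e\ge1$, the braid group $B(de,e,r)$ of the complex reflection group $G(de,e,r)$ is the group with generators $z$, $t_i$ ($i\in\mathbb{Z}$), $s_3,\ldots,s_r$ and relations: $s_is_j=s_js_i$ for $|i-j|\ge2$; $s_is_{i+1}s_i=s_{i+1}s_is_{i+1}$ for $3\le i\le r-1$; $t_it_{i-1}=t_jt_{j-1}$ for $i,j\in\mathbb{Z}$; $s_3t_is_3=t_is_3t_i$ for $i\in\mathbb{Z}$; $s_jt_i=t_is_j$ for $i\in\mathbb{Z}$, $4\le j\le r$; $zt_i=t_{i-e}z$ for $i\in\mathbb{Z}$; $zs_j=s_jz$ for $3\le j\le r$. $B(\infty,\infty,r)$ is the group with generators $t_i$ ($i\in\mathbb{Z}$), $s_3,\ldots,s_r$ and those of these relations not involving $z$. If $r=2$ there are no $s_j$. Both groups are finitely generated (each $t_i$ lies in the subgroup generated by $t_0,t_1$). For a finitely generated group $G$ and a finite set $X$ of semigroup generators for $G$, the translation number of $g\in G$ with respect to $X$ is $t_{G,X}(g)=\liminf_{n\to\infty}|g^n|_X/n$, where $|\cdot|_X$ is the minimal word length in the alphabet $X$. The group $G$ is - translation separable if for some (and hence any) finite set $X$ of semigroup generators for $G$ the translation numbers of non-torsion elements are strictly positive; - translation discrete if it is translation separable and for some (and hence any) finite set $X$ of semigroup generators for $G$ the set $t_{G,X}(G)$ has $0$ as an isolated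 point; - strongly translation discrete if it is translation separable and for some (and hence any) finite set $X$ of semigroup generators for $G$ and for any real number $\rho$, the number of conjugacy classes $[g]=\{h^{-1}gh\mid h\in G\}$ with $t_{G,X}(g)\le\rho$ is finite (the translation number is constant on conjugacy classes). *)

(* Defs.v *)
From HB Require Import structures.
From mathcomp Require Import all_boot all_order all_algebra.
From mathcomp Require Import all_classical all_reals all_analysis.

Set Implicit Arguments.
Unset Strict Implicit.
Unset Printing Implicit Defensive.

Import Order.TTheory GRing.Theory Num.Theory.
Import numFieldNormedType.Exports.
Local Open Scope quotient_scope.

Section Presentation.

(* [rel u v] is the defining relation u = v between positive words over the
   generators I. *)
Variables (I : choiceType) (rel : seq I -> seq I -> Prop).

(* A letter (x, false) is the generator x, and (x, true) is its inverse. *)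
Definition word := seq (I * bool).

Definition pos_word (u : seq I) : word := [seq (x, false) | x <- u].
Definition word_inv (u : word) : word := rev [seq (a.1, ~~ a.2) | a <- u].

Inductive word_eq : word -> word -> Prop :=
| WeqRefl u : word_eq u u
| WeqSym u v : word_eq u v -> word_eq v u
| WeqTrans u v w : word_eq u v -> word_eq v w -> word_eq u w
| WeqCat u u' v v' : word_eq u u' -> word_eq v v' -> word_eq (u ++ v) (u' ++ v')
| WeqCancel x b : word_eq [:: (x, b); (x, ~~ b)] [::]
| WeqRel u v : rel u v -> word_eq (pos_word u) (pos_word v).

Definition word_eqb (u v : word) : bool := `[< word_eq u v >].

Lemma word_eqb_equiv : equiv_class_of word_eqb.
Proof.
split=> [u|u v|v u w].
- exact/asboolP/WeqRefl.
- by apply/asboolP/asboolP; exact: WeqSym.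
- by move=> /asboolP uv /asboolP vw; apply/asboolP; exact: WeqTrans uv vw.
Qed.

Canonical word_equiv := EquivRelPack word_eqb_equiv.

Definition presented := {eq_quot word_equiv}.

HB.instance Definition _ := Choice.on presented.
HB.instance Definition _ := EqQuotient.on presented.

Lemma word_eqP (u v : word) :
  reflect (word_eq u v) (\pi_presented u == \pi_presented v).
Proof. by rewrite eqmodE; exact: asboolP. Qed.

Definition pmul (x y : presented) : presented := \pi_presented (repr x ++ repr y).
Definition pinv (x : presented) : presented := \pi_presented (word_inv (repr x)).
Definition pone : presented := \pi_presented [::].

Lemma word_inv_cat u v : word_inv (u ++ v) = word_inv v ++ word_inv u.
Proof. by rewrite /word_inv map_cat rev_cat. Qed.

Lemma word_invK u : word_inv (word_inv u) = u.
Proof.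
rewrite /word_inv map_rev revK -map_comp -[RHS]map_id.
by apply: eq_map => -[x b] /=; rewrite negbK.
Qed.

Lemma word_mulV u : word_eq (u ++ word_inv u) [::].
Proof.
elim: u => [|[x b] u IHu]; first exact: WeqRefl.
rewrite -cat1s word_inv_cat -catA (catA u).
apply: (WeqTrans (v := [:: (x, b)] ++ ([::] ++ word_inv [:: (x, b)]))).
  exact: WeqCat (WeqRefl _) (WeqCat IHu (WeqRefl _)).
exact: WeqCancel.
Qed.

Lemma word_mulVl u : word_eq (word_inv u ++ u) [::].
Proof. by have := word_mulV (word_inv u); rewrite word_invK. Qed.

Lemma pi_repr (u : word) : word_eq (repr (\pi_presented u)) u.
Proof. by apply/word_eqP; rewrite reprK. Qed.

Lemma pmulE (u v : word) : pmul (\pi_presented u) (\pi_presented v) = \pi_presented (u ++ v).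
Proof. by apply/eqP/word_eqP; apply: WeqCat; exact: pi_repr. Qed.

Lemma pmulA : associative pmul.
Proof.
move=> x y z; rewrite -[x]reprK -[y]reprK -[z]reprK.
by rewrite (pmulE (repr y)) pmulE (pmulE (repr x)) pmulE catA.
Qed.

Lemma pmul1 : left_id pone pmul.
Proof. by move=> x; rewrite -[x in LHS]reprK pmulE reprK. Qed.

Lemma pmulr1 : right_id pone pmul.
Proof. by move=> x; rewrite -[x in LHS]reprK pmulE cats0 reprK. Qed.

Lemma pmulV : left_inverse pone pinv pmul.
Proof.
move=> x; rewrite -{2}[x]reprK pmulE.
exact/eqP/word_eqP/word_mulVl.
Qed.

Lemma pmulrV : right_inverse pone pinv pmul.
Proof.
move=> x; rewrite -{1}[x]reprK pmulE.
exact/eqP/word_eqP/word_mulV.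
Qed.

HB.instance Definition _ :=
  isGroup.Build presented pmulA pmul1 pmulr1 pmulV pmulrV.

End Presentation.

Section BraidGroups.

Variable r : nat.

(* The indices 3, ..., r of the generators s_j; there are none when r = 2. *)
Definition sidx := {j : nat | 3 <= j <= r}.

(* The relations not involving z, over any alphabet with letters t i and s j. *)
Inductive ts_rel (I : Type) (t : int -> I) (s : sidx -> I) :
  seq I -> seq I -> Prop :=
| RelComm (j k : sidx) : (2 <= `|(val j)%:Z - (val k)%:Z|)%R ->
    ts_rel t s [:: s j; s k] [:: s k; s j]
| RelBraid (j k : sidx) : val k = (val j).+1 ->
    ts_rel t s [:: s j; s k; s j] [:: s k; s j; s k]
| RelTT (i j : int) : ts_rel t s [:: t i; t (i - 1)%R] [:: t j; t (j - 1)%R]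
| RelTS3 (i : int) (j : sidx) : val j = 3 ->
    ts_rel t s [:: s j; t i; s j] [:: t i; s j; t i]
| RelTS (i : int) (j : sidx) : 4 <= val j ->
    ts_rel t s [:: s j; t i] [:: t i; s j].

Inductive gen_inf := InfT of int | InfS of sidx.

HB.instance Definition _ := gen_eqMixin gen_inf.
HB.instance Definition _ := gen_choiceMixin gen_inf.

(* B(oo,oo,r) *)
Definition braid_inf : groupType := presented (ts_rel InfT InfS).

Inductive gen_fin := FinZ | FinT of int | FinS of sidx.

HB.instance Definition _ := gen_eqMixin gen_fin.
HB.instance Definition _ := gen_choiceMixin gen_fin.

Inductive zts_rel (e : nat) : seq gen_fin -> seq gen_fin -> Prop :=
| RelNoZ u v : ts_rel FinT FinS u v -> zts_rel e u v
| RelZT (i : int) : zts_rel e [:: FinZ; FinT i] [:: FinT (i - e%:Z)%R; FinZ]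
| RelZS (j : sidx) : zts_rel e [:: FinZ; FinS j] [:: FinS j; FinZ].

End BraidGroups.

(* B(de,e,r); the presentation does not involve d. *)
Definition braid (d e r : nat) : groupType := presented (@zts_rel r e).

Section TranslationNumbers.

Local Open Scope classical_set_scope.

Variables (R : realType) (G : groupType).
Implicit Types (X : set G) (g : G) (n : nat) (w : seq G).

Definition word_for X g w :=
  (forall x, x \in w -> X x) /\ (\prod_(x <- w) x)%g = g.

Definition finite_semigroup_generators X :=
  finite_set X /\ forall g, exists w, w != [::] /\ word_for X g w.

(* The empty word is allowed here, so 1 has length 0.  The value is 0 if X does
   not generate g, which never happens when X generates G. *)
Definition word_length X g : nat :=
  xget 0 [set n | (exists2 w, word_for X g w & size w = n) /\
                  forall w, word_for X g w -> n <= size w].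

Definition translation_number X g : R :=
  limn_inf (fun n => (word_length X (g ^+ n)%g)%:R / n%:R : R)%R.

Definition torsion g := exists2 n, 0 < n & (g ^+ n = 1)%g.

Definition conjugacy_class g : set G := [set (g ^ h)%g | h in [set: G]].

(* "For some, and hence any, finite set X of semigroup generators": a
   generating set exists, and P holds for each of them. *)
Definition for_some_and_any_generators (P : set G -> Prop) :=
  (exists X, finite_semigroup_generators X) /\
  (forall X, finite_semigroup_generators X -> P X).

Definition translation_separable :=
  for_some_and_any_generators (fun X =>
    forall g, ~ torsion g -> (0 < translation_number X g)%R).

Definition translation_discrete :=
  translation_separable /\
  for_some_and_any_generators (fun X =>
    isolated (range (translation_number X)) 0%R).

Definition strongly_translation_discrete :=
  translation_separable /\
  for_some_and_any_generators (fun X =>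
    forall rho : R,
      finite_set [set conjugacy_class g | g in
                    [set g | (translation_number X g <= rho)%R]]).

End TranslationNumbers.

(* Main.v *)
Require Import Defs.
From mathcomp Require Import all_boot all_order all_algebra.
From mathcomp Require Import all_classical all_reals all_analysis.
From mathcomp Require Import zify.

(* Let Q be the Artin group of type B_r. Sending t_i to z^-i t z^i embeds
   B(oo,oo,r) in Q as the kernel of the winding number, Q being the semidirect
   product of B(oo,oo,r) by <z>; sending moreover z to z^e embeds B(de,e,r) with
   finite index. In the Artin monoid of type B_r the cube condition holds, hence
   left cancellation and right lcms, and the product D of the Jucys-Murphy
   elements is central and divisible by every generator. So left divisibility
   extends to a left invariant lattice order on Q, with positive cone P.

   If g^n is in P, then x = lub(1, g, ..., g^(n-1)) satisfies g x >= x, so g is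
   conjugate to an element of P. When the translation number of g is at most rho,
   this applies to g D^k with k depending only on rho, and the weight of g is
   bounded as well, so that g is conjugate into a finite set. When it is very small,
   the weight of g is 0 and, after conjugation, g^N D is in P; conjugating by
   lub(1, g, ..., g^(N-1)) puts all g^j D (j <= N) in P. These have the weight
   of D, so two of them coincide if N is large, and g is torsion. *)

Set Implicit Arguments.
Unset Strict Implicit.
Unset Printing Implicit Defensive.

Import Order.TTheory GRing.Theory Num.Theory.
Import numFieldNormedType.Exports.

(** * Artin monoids by word reversing *)

Section ArtinMonoid.

Variables (I : Type) (m : I -> I -> nat).

Fixpoint alternating (n : nat) (i j : I) : seq I :=
  if n is n'.+1 then i :: alternating n' j i else [::].

(** For positive [m i j], completes [i] to the alternating word of length [m i j] that begins with
    [i], one side of the Artin relation of [i] and [j]. *)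
Definition compl (i j : I) : seq I := alternating (m i j).-1 j i.

Inductive artin_step : seq I -> seq I -> Prop :=
  ArtinStep l i j s : artin_step (l ++ i :: compl i j ++ s) (l ++ j :: compl j i ++ s).

(** A chain of steps, the form on which the induction in [reducible] runs; a step is reversed by
    exchanging [i] and [j], whence symmetry. *)
Inductive peq : seq I -> seq I -> Prop :=
| PeqRefl u : peq u u
| PeqCons u v w : artin_step u v -> peq v w -> peq u w.

Lemma peq_trans u v w : peq u v -> peq v w -> peq u w.
Proof. by elim=> // {}u {}v v' st _ IH /IH; exact: PeqCons. Qed.

Lemma peq_step u v : artin_step u v -> peq u v.
Proof. by move=> st; exact: PeqCons st (PeqRefl v). Qed.

Lemma peq_sym u v : peq u v -> peq v u.
Proof.
elim=> [{}u|{}u {}v w [l i j s] _ IH]; first exact: PeqRefl.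
exact/(peq_trans IH)/peq_step/ArtinStep.
Qed.

Lemma peq_cat u u' v v' : peq u u' -> peq v v' -> peq (u ++ v) (u' ++ v').
Proof.
move=> uu' vv'; apply: (@peq_trans _ (u ++ v')).
- elim: vv' => [w|a b c [l i j s] _]; first exact: PeqRefl.
  by apply: PeqCons; rewrite !catA; exact: ArtinStep.
- elim: uu' => [w|a b c [l i j s] _]; first exact: PeqRefl.
  by apply: PeqCons; rewrite -!catA !cat_cons -!catA; exact: ArtinStep.
Qed.

Lemma peq_catl w u v : peq u v -> peq (w ++ u) (w ++ v).
Proof. by move=> uv; apply: peq_cat uv; exact: PeqRefl. Qed.

Lemma peq_catr w u v : peq u v -> peq (u ++ w) (v ++ w).
Proof. by move=> uv; apply: (peq_cat uv); exact: PeqRefl. Qed.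

Lemma peq_rel i j w : peq (i :: compl i j ++ w) (j :: compl j i ++ w).
Proof. exact/peq_step/(@ArtinStep [::]). Qed.

(* Word reversing: a derivation computes the right lcm [u ++ x ~ v ++ y] of
   [u] and [v]. *)
Inductive lcmw : seq I -> seq I -> seq I -> seq I -> Prop :=
| LcmNill v : lcmw [::] v v [::]
| LcmNilr u : lcmw u [::] [::] u
| LcmCons i j u v p q p' q' s s' :
    lcmw u (compl i j) p q -> lcmw v (compl j i) p' q' -> lcmw q q' s s' ->
    lcmw (i :: u) (j :: v) (p ++ s) (p' ++ s').

(** [n] is fuel: [None] only says that it ran out. *)
Fixpoint reverse (n : nat) (u v : seq I) : option (seq I * seq I) :=
  match n, u, v with
  | _, [::], _ => Some (v, [::])
  | _, _, [::] => Some ([::], u)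
  | n'.+1, i :: u', j :: v' =>
    if reverse n' u' (compl i j) is Some (p, q) then
      if reverse n' v' (compl j i) is Some (p', q') then
        if reverse n' q q' is Some (s, s') then Some (p ++ s, p' ++ s')
        else None
      else None
    else None
  | _, _, _ => None
  end.

Lemma reverseP n u v x y : reverse n u v = Some (x, y) -> lcmw u v x y.
Proof.
elim: n u v x y => [|n IH] [|i u] [|j v] x y //=;
  try by case=> <- <-; constructor.
case E1: (reverse n u _) => [[p q]|//]; case E2: (reverse n v _) => [[p' q']|//].
case E3: (reverse n q q') => [[s s']|//] [<- <-].
by apply: LcmCons (IH _ _ _ _ E1) (IH _ _ _ _ E2) (IH _ _ _ _ E3).
Qed.

Lemma lcmw_peq u v x y : lcmw u v x y -> peq (u ++ x) (v ++ y).
Proof.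
elim=> {u v x y} [v|u|i j u v p q p' q' s s' _ IH1 _ IH2 _ IH3].
- by rewrite cats0; exact: PeqRefl.
- by rewrite cats0; exact: PeqRefl.
- rewrite !cat_cons; apply: (@peq_trans _ (i :: compl i j ++ q ++ s)).
    by rewrite (catA u) (catA (compl _ _)); exact/(@peq_catl [:: i])/peq_catr.
  apply: peq_trans (peq_rel _ _ _) _.
  rewrite -cat1s -(cat1s j (v ++ _)); apply: peq_catl.
  rewrite (catA v); apply: (@peq_trans _ (compl j i ++ q' ++ s')).
    exact: peq_catl.
  by rewrite catA; exact/peq_catr/peq_sym.
Qed.

End ArtinMonoid.

Section MapLetters.

Variables (I J : Type) (m : I -> I -> nat) (m' : J -> J -> nat) (f : J -> I).
Hypothesis fm : forall x y, m (f x) (f y) = m' x y.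

Lemma map_compl x y : map f (compl m' x y) = compl m (f x) (f y).
Proof.
rewrite /compl fm; move: (m' x y).-1 => n.
by elim: n x y => //= n IH x y; rewrite IH.
Qed.

(** Carries the derivations computed over [three] to any letters with the same exponents. *)
Lemma map_lcmw u v x y :
  lcmw m' u v x y -> lcmw m (map f u) (map f v) (map f x) (map f y).
Proof.
elim=> {u v x y} [v|u|i j u v p q p' q' s s' _ IH1 _ IH2 _ IH3];
  try exact: LcmNill; try exact: LcmNilr.
rewrite !map_cat /=; rewrite !map_compl in IH1 IH2.
exact: LcmCons IH1 IH2 IH3.
Qed.

End MapLetters.

Variant three := L0 | L1 | L2.

Definition m3 (p q t : nat) (x y : three) : nat :=
  match x, y with
  | L0, L1 | L1, L0 => p
  | L1, L2 | L2, L1 => q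
  | L0, L2 | L2, L0 => t
  | _, _ => 1
  end.

(* Dehornoy's cube condition on the triple of letters (L0, L1, L2) with pivot
   L1, decided by word reversing. *)
Definition cube_ok (p q t : nat) : bool :=
  let c := compl (m3 p q t) in
  (* Fuel 20 suffices for all triples of type B, as the computation in [mB_cube] shows. *)
  let rev := reverse (m3 p q t) 20 in
  if rev (c L1 L0) (c L1 L2) is Some (x, y) then
    match rev (c L0 L2) (c L0 L1 ++ x), rev (c L2 L0) (c L2 L1 ++ y) with
    | Some (v, [::]), Some (v', [::]) =>
        if rev v v' is Some ([::], [::]) then true else false
    | _, _ => false
    end
  else false.

(** * Cancellation and right lcms from the cube condition *)

Section Reduction.

Variables (I : eqType) (m : I -> I -> nat).
Hypothesis m_sym : forall i j, m i j = m j i.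
Hypothesis m_diag : forall i, m i i = 1.
Hypothesis cube : forall i j k, i != j -> j != k -> i != k ->
  cube_ok (m i j) (m j k) (m i k).

Local Notation compl := (compl m).
Local Notation peq := (peq m).
Local Notation lcmw := (lcmw m).

Lemma compl_diag i : compl i i = [::].
Proof. by rewrite /compl m_diag. Qed.

Lemma size_compl i j : size (compl i j) = size (compl j i).
Proof.
have size_alt n (x y : I) : size (alternating n x y) = n.
  by elim: n x y => //= n IH x y; rewrite IH.
by rewrite /compl !size_alt m_sym.
Qed.

Lemma size_peq u v : peq u v -> size u = size v.
Proof.
elim=> // {}u {}v w [l i j s] _ <-.
by rewrite !size_cat /= !size_cat (size_compl i j).
Qed.

Lemma size_peq_cons i j X Y : peq (i :: X) (j :: Y) -> size X = size Y.
Proof. by move/size_peq => [->]. Qed.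

(** The lcm of [compl k i] and [compl k j] yields a common multiple of [i], [k], [j] through the
    pivot [k]. The cube condition says that it factors through the lcm of [i] and [j], with quotient
    [v]; the test computes this quotient from each side and compares the two. *)
Lemma cubeP i k j : i != k -> k != j -> i != j ->
  exists x y v, [/\ lcmw (compl k i) (compl k j) x y,
    peq (compl i k ++ x) (compl i j ++ v) &
    peq (compl j k ++ y) (compl j i ++ v)].
Proof.
move=> nik nkj nij; have := cube nik nkj nij; rewrite /cube_ok.
set m' := m3 _ _ _; pose f x := match x with L0 => i | L1 => k | L2 => j end.
have fm x y : m (f x) (f y) = m' x y.
  by case: x; case: y; rewrite /m' ?m_diag //= m_sym.
case E1: (reverse _ _ _ (_ L1 L2)) => [[x y]|//].
case E2: (reverse _ _ (_ L0 L2) _) => [[v [|//]]|//].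
case E3: (reverse _ _ (_ L2 L0) _) => [[v' [|//]]|//].
case E4: (reverse _ _ v v') => [[[|//] [|//]]|//] _.
exists (map f x), (map f y), (map f v).
move/reverseP/(map_lcmw fm): E1.
move/reverseP/(map_lcmw fm)/lcmw_peq: E2.
move/reverseP/(map_lcmw fm)/lcmw_peq: E3.
move/reverseP/(map_lcmw fm)/lcmw_peq: E4.
rewrite !map_cat !(map_compl fm) /= !cats0 => vv' E3 E2 E1.
split=> //; first exact: peq_sym.
by apply: peq_trans (peq_sym E3) _; apply/peq_catl/peq_sym.
Qed.

(** Universality of the lcm of two letters, cut off by length so that its consequences are available
    inside the induction that proves it. *)
Definition reducible_below n := forall i j X Y, size X < n ->
  peq (i :: X) (j :: Y) ->
  exists2 W, peq X (compl i j ++ W) & peq Y (compl j i ++ W).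

(** Induction on the derivation: reduction treats the leading letters, then the three smaller
    derivations are filled in one after the other. The lengths stay below the cut-off because the
    relations are homogeneous. *)
Lemma lcmw_univ_below n u v x y A B : reducible_below n ->
  lcmw u v x y -> size (u ++ A) <= n -> peq (u ++ A) (v ++ B) ->
  exists2 W, peq A (x ++ W) & peq B (y ++ W).
Proof.
move=> red uv; elim: uv A B => {u v x y}
    [v|u|i j u v p q p' q' s s' _ IH1 _ IH2 _ IH3] A B.
- by move=> _ AB; exists B => //; exact: PeqRefl.
- by move=> _ AB; exists A; [exact: PeqRefl|exact: peq_sym].
rewrite !cat_cons -[size (i :: _)]/(size (u ++ A)).+1 => lt_n iujv.
have [W0 uW0 vW0] := red _ _ _ _ lt_n iujv.
have [W1 AW1 W01] := IH1 _ _ (ltnW lt_n) uW0.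
have le_v : size (v ++ B) <= n by rewrite -(size_peq_cons iujv) ltnW.
have [W2 BW2 W02] := IH2 _ _ le_v vW0.
have le_q : size (q ++ W1) <= n.
  rewrite -(size_peq W01); apply: leq_trans (ltnW lt_n).
  by rewrite (size_peq uW0) size_cat leq_addl.
have [W W1W W2W] := IH3 _ _ le_q (peq_trans (peq_sym W01) W02).
by exists W; [apply: peq_trans AW1 _|apply: peq_trans BW2 _];
  rewrite -catA; exact: peq_catl.
Qed.

Lemma cancel_below n i X Y : reducible_below n -> size X < n ->
  peq (i :: X) (i :: Y) -> peq X Y.
Proof.
move=> red lt_n XY; have [W] := red _ _ _ _ lt_n XY.
rewrite compl_diag => XW YW; exact: peq_trans XW (peq_sym YW).
Qed.

Lemma catl_cancel_below n u X Y : reducible_below n -> size (u ++ X) <= n ->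
  peq (u ++ X) (u ++ Y) -> peq X Y.
Proof.
move=> red; elim: u => //= i u IH lt_n uXY.
exact: IH (ltnW lt_n) (cancel_below red lt_n uXY).
Qed.

Lemma step_reduce i k X Z : artin_step m (i :: X) (k :: Z) ->
  exists2 A, peq X (compl i k ++ A) & peq Z (compl k i ++ A).
Proof.
move EU: (i :: X) => U; move EV: (k :: Z) => V st.
case: st EU EV => -[|c l] a b s [-> ->] [-> ->].
  by exists s; exact: PeqRefl.
rewrite compl_diag; exists (l ++ b :: compl b a ++ s); last exact: PeqRefl.
exact/peq_step/ArtinStep.
Qed.

(* Garside's reduction lemma. *)
Lemma reducible n : reducible_below n.
Proof.
elim: n => // n red i j X Y lt_n iXjY.
(* Besides the induction on the length there is one on the chain of steps; naming the endpoints lets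
   the leading letter of the source vary. *)
have [U [V [EU EV UV]]] : exists U V, [/\ U = i :: X, V = j :: Y & peq U V].
  by exists (i :: X), (j :: Y).
elim: UV i X lt_n {iXjY} EU EV => {U V} [U i X lt_n ->|U V T st _ IH i X lt_n EU ET].
  by case=> <- <-; rewrite compl_diag; exists X; exact: PeqRefl.
case: V st IH => [|k Z] st IH.
  by have := size_peq (peq_step st); rewrite EU.
have XZ : size X = size Z.
  by apply: (@size_peq_cons i k); rewrite -EU; exact: peq_step.
have lt_nZ : size Z < n.+1 by rewrite -XZ.
have [B ZB YB] := IH k Z lt_nZ erefl ET.
rewrite EU in st; have [A XA ZA] := step_reduce st.
have [eik|nik] := eqVneq i k.
  move: XA ZA; rewrite eik compl_diag => XA ZA.
  exists B => //; apply: peq_trans XA _; exact: peq_trans (peq_sym ZA) ZB.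
have [ekj|nkj] := eqVneq k j.
  move: ZB YB; rewrite -ekj compl_diag => ZB YB.
  exists A => //; apply: peq_trans YB _; exact: peq_trans (peq_sym ZB) ZA.
have le_n : size (compl k i ++ A) <= n by rewrite -(size_peq ZA) -XZ.
have AB := peq_trans (peq_sym ZA) ZB.
have [eij|nij] := eqVneq i j.
  move: YB AB; rewrite -eij compl_diag => YB AB.
  have {}AB := catl_cancel_below red le_n AB.
  exists X; first exact: PeqRefl.
  apply: peq_trans YB _; apply: peq_trans (peq_sym XA).
  exact/peq_catl/peq_sym.
(* With three distinct letters, [compl k i ++ A] and [compl k j ++ B] are equal, so [A] and [B]
   begin with [x] and [y] and share the rest [W]. The cube condition trades the detour through [k]
   for the lcm of [i] and [j]. *)
have [x [y [v [lcm_xy xv yv]]]] := cubeP nik nkj nij.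
have [W AW BW] := lcmw_univ_below red lcm_xy le_n AB.
exists (v ++ W).
- apply: peq_trans XA _; apply: peq_trans (peq_catl _ AW) _.
  by rewrite !catA; exact: peq_catr.
- apply: peq_trans YB _; apply: peq_trans (peq_catl _ BW) _.
  by rewrite !catA; exact: peq_catr.
Qed.

Lemma peq_catlI u X Y : peq (u ++ X) (u ++ Y) -> peq X Y.
Proof. exact: (catl_cancel_below (reducible (n := _)) (leqnn _)). Qed.

Lemma lcmw_univ u v x y A B : lcmw u v x y -> peq (u ++ A) (v ++ B) ->
  exists2 W, peq A (x ++ W) & peq B (y ++ W).
Proof. by move=> uv; apply: (lcmw_univ_below (reducible (n := _)) uv (leqnn _)). Qed.

(** Word reversing terminates once a common multiple exists, because each subproblem has a strictly
    shorter one. *)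
Lemma lcmw_exists u v A B : peq (u ++ A) (v ++ B) ->
  exists x y, lcmw u v x y.
Proof.
have [n] := ubnP (size (u ++ A)).
elim: n u v A B => // n IH [|i u] v A B; first by exists v, [::]; constructor.
case: v => [|j v] /= lt_n uAvB; first by exists [::], (i :: u); constructor.
have [W uW vW] := reducible (ltnSn _) uAvB.
have [p [q pq]] := IH _ _ _ _ lt_n uW.
have lt_nv : size (v ++ B) < n by rewrite -(size_peq_cons uAvB).
have [p' [q' pq']] := IH _ _ _ _ lt_nv vW.
have [W1 _ W1q] := lcmw_univ pq uW; have [W2 _ W2q] := lcmw_univ pq' vW.
have [|s [s' ss']] := IH q q' W1 W2 _ (peq_trans (peq_sym W1q) W2q).
  rewrite -(size_peq W1q); apply: leq_trans (ltnSE lt_n).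
  by rewrite (size_peq uW) size_cat ltnS leq_addl.
by exists (p ++ s), (p' ++ s'); exact: LcmCons pq pq' ss'.
Qed.

End Reduction.

(** * The monoid of type B and its Garside element *)

(** Coxeter matrix of type B: a chain 0, 1, 2, ... with label 4 on the edge at 0 and label 3 on the
    other edges. *)
Definition mB (i j : nat) : nat :=
  if i == j then 1
  else if (i.+1 == j) || (j.+1 == i) then
    if (i == 0) || (j == 0) then 4 else 3
  else 2.

Lemma mB_sym i j : mB i j = mB j i.
Proof. by rewrite /mB eq_sym orbC [(i == 0) || _]orbC. Qed.

Lemma mB_diag i : mB i i = 1.
Proof. by rewrite /mB eqxx. Qed.

(** The exponents depend only on which indices are adjacent and which is 0. This leaves finitely
    many patterns, each contradictory or settled by running the reversing. *)
Lemma mB_cube i j k : i != j -> j != k -> i != k ->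
  cube_ok (mB i j) (mB j k) (mB i k).
Proof.
move=> nij njk nik; rewrite /mB (negbTE nij) (negbTE njk) (negbTE nik).
case: (boolP (i.+1 == j)) => h1; case: (boolP (j.+1 == i)) => h2;
case: (boolP (j.+1 == k)) => h3; case: (boolP (k.+1 == j)) => h4;
case: (boolP (i.+1 == k)) => h5; case: (boolP (k.+1 == i)) => h6;
  try (by exfalso; lia);
case: (boolP (i == 0)) => h7; case: (boolP (j == 0)) => h8;
case: (boolP (k == 0)) => h9; first [by vm_compute|by exfalso; lia].
Qed.

Section GarsideElementB.

Variable n : nat.

Definition mBo (i j : 'I_n.+1) : nat := mB i j.

Local Notation peq := (peq mBo).
Local Notation l k := (@inord n k).

Let comm u v := peq (u ++ v) (v ++ u).

Let comm_sym u v : comm u v -> comm v u.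
Proof. exact: peq_sym. Qed.

Let comm_cat u v w : comm u v -> comm u w -> comm u (v ++ w).
Proof.
rewrite /comm => uv uw; rewrite catA -(catA v w u).
by apply: peq_trans (peq_catr _ uv) _; rewrite -?catA; exact: peq_catl.
Qed.

Let comm_cons u x w : comm u [:: x] -> comm u w -> comm u (x :: w).
Proof. exact: comm_cat. Qed.

Let mBl i j : i <= n -> j <= n -> mBo (l i) (l j) = mB i j.
Proof. by move=> le_i le_j; rewrite /mBo !inordK. Qed.

Let peq_rel0 i j : peq (i :: compl mBo i j) (j :: compl mBo j i).
Proof. by have := peq_rel mBo i j [::]; rewrite !cats0. Qed.

Lemma artinB_far i j : i.+1 < j -> j <= n ->
  peq [:: l j; l i] [:: l i; l j].
Proof.
move=> lt_ij le_j; have := peq_rel0 (l j) (l i).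
rewrite /compl !mBl; try lia.
have mB2 : mB i j = 2.
  by rewrite /mB; do 2 (case: ifP => ?; first lia).
by rewrite mB_sym mB2.
Qed.

Lemma artinB_braid i : 0 < i -> i < n ->
  peq [:: l i; l i.+1; l i] [:: l i.+1; l i; l i.+1].
Proof.
move=> gt0 lt_n; have := peq_rel0 (l i) (l i.+1).
rewrite /compl !mBl; try lia.
have mB3 : mB i i.+1 = 3.
  by rewrite /mB eqxx; do 2 (case: ifP => ?; try lia).
by rewrite [mB i.+1 i]mB_sym mB3.
Qed.

Lemma artinB_braid4 : 0 < n -> peq [:: l 0; l 1; l 0; l 1] [:: l 1; l 0; l 1; l 0].
Proof. by move=> gt0; have := peq_rel0 (l 0) (l 1); rewrite /compl !mBl. Qed.

(* Jucys-Murphy elements: the (k+1)-st strand encircles the axis and the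
   first k strands. *)
Fixpoint jm (k : nat) : seq 'I_n.+1 :=
  if k is k'.+1 then l k :: jm k' ++ [:: l k] else [:: l 0].

Lemma jm_comm_gt j k : k.+1 < j -> j <= n -> comm [:: l j] (jm k).
Proof.
elim: k => [|k IH] lt_j le_n; first exact: artinB_far.
apply: comm_cons; first exact: artinB_far.
apply: comm_cat; last exact: artinB_far.
by apply: IH => //; lia.
Qed.

(** In the critical case, write p = [l k.+1] and q = [l k.+2], so that [jm k.+2] is q p (jm k) p q.
    Put p in front: a braid relation carries it over as q, which passes [jm k], and a second braid
    relation turns it back into p. At the bottom of the chain this is the relation of length 4. *)
Lemma jm_comm_lt j k : j < k -> k <= n -> comm [:: l j] (jm k).
Proof.
elim: k => // k IH; rewrite ltnS leq_eqVlt => /predU1P[-> lt_n|lt_jk lt_n]; last first.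
  have jk : comm [:: l j] [:: l k.+1] by exact/comm_sym/artinB_far.
  apply: comm_cons => //; apply: comm_cat => //.
  by apply: IH => //; lia.
case: k {IH} lt_n => [|k] lt_n; rewrite /comm /=; first exact: artinB_braid4.
have kE : comm [:: l k.+2] (jm k) by exact: jm_comm_gt.
have br := @artinB_braid k.+1 isT lt_n.
apply: (@peq_trans _ _ _
    ([:: l k.+2; l k.+1; l k.+2] ++ jm k ++ [:: l k.+1; l k.+2])).
  have := peq_catr (jm k ++ [:: l k.+1; l k.+2]) br.
  by rewrite /= -?catA.
apply: (@peq_trans _ _ _
    ([:: l k.+2; l k.+1] ++ (jm k ++ [:: l k.+2]) ++ [:: l k.+1; l k.+2])).
  have := peq_catl [:: l k.+2; l k.+1] (peq_catr [:: l k.+1; l k.+2] kE).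
  by rewrite /= -?catA.
have := peq_catl ([:: l k.+2; l k.+1] ++ jm k) (peq_sym br).
by rewrite /= -?catA /= -?catA.
Qed.

Lemma jm_comm i k : i < k -> k <= n -> comm (jm i) (jm k).
Proof.
elim: i => [|i IH] lt_ik le_k; first exact: jm_comm_lt.
apply: comm_sym; apply: comm_cons; last apply: comm_cat.
- exact/comm_sym/jm_comm_lt.
- by apply/comm_sym/IH => //; lia.
- exact/comm_sym/jm_comm_lt.
Qed.

Fixpoint jm_prod (k : nat) : seq 'I_n.+1 :=
  if k is k'.+1 then jm_prod k' ++ jm k' else [::].

Lemma jm_prod_comm_gt j k : k < j -> j <= n -> comm [:: l j] (jm_prod k).
Proof.
elim: k => [|k IH] lt_kj le_n /=; first by rewrite /comm cats0; exact: PeqRefl.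
by apply: comm_cat; [apply: IH => //; lia|exact: jm_comm_gt].
Qed.

Lemma jm_prod_comm j k : j < k -> k <= n.+1 -> comm [:: l j] (jm_prod k).
Proof.
elim: k => // k IH; rewrite ltnS leq_eqVlt => /predU1P[-> le_n|lt_jk le_n]; last first.
  apply: comm_cat; last exact: jm_comm_lt.
  by apply: IH => //; lia.
case: k {IH} le_n => [|k] le_n; first exact: PeqRefl.
have -> : jm_prod k.+2 = jm_prod k ++ (jm k ++ jm k.+1) by rewrite /= catA.
apply: comm_cat; first exact: jm_prod_comm_gt.
(* Since [jm k.+1] is [jm k] between two letters p = [l k.+1], the product p (jm k) (jm k.+1) equals
   (jm k.+1) (jm k) p, and the two elements commute. *)
have := peq_sym (peq_catr [:: l k.+1] (jm_comm (ltnSn k) le_n)).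
by rewrite /comm /= -?catA /= -?catA.
Qed.

Lemma jm_jm_prod_comm j k : k <= j -> j <= n -> comm (jm j) (jm_prod k).
Proof.
elim: k => [|k IH] lt_kj le_n /=; first by rewrite /comm cats0; exact: PeqRefl.
apply: comm_cat; last exact/comm_sym/jm_comm.
by apply: IH => //; lia.
Qed.

Definition deltaB := jm_prod n.+1.

Lemma deltaB_comm i : comm [:: i] deltaB.
Proof. by have := @jm_prod_comm i n.+1 (ltn_ord i) (leqnn _); rewrite inord_val. Qed.

(** [jm k] begins with the letter [k] and can be moved to the front of the product of its
    predecessors. *)
Lemma deltaB_divl i : exists w, peq (i :: w) deltaB.
Proof.
suff: forall k, i < k -> k <= n.+1 -> exists w, peq (i :: w) (jm_prod k).
  by apply; [exact: ltn_ord|].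
elim=> // k IH; rewrite ltnS leq_eqVlt => /predU1P[Ek le_n|lt_jk le_n]; last first.
  have [|w iw] := IH lt_jk; first by lia.
  by exists (w ++ jm k); rewrite -cat_cons; exact: peq_catr.
have [w jmE] : exists w, jm k = i :: w.
  by rewrite -(inord_val i) Ek; case: (k) => [|k'] /=; eexists.
exists (w ++ jm_prod k); rewrite -cat_cons -jmE.
exact: jm_jm_prod_comm.
Qed.

End GarsideElementB.

(** * Artin groups with a Garside element *)

Local Open Scope quotient_scope.
Local Open Scope group_scope.

Section Presented.

Variables (I : choiceType) (rel : seq I -> seq I -> Prop).

Local Notation G := (presented rel).

Definition cls (w : word I) : G := \pi_G w.

Lemma cls_eqP u v : cls u = cls v <-> word_eq rel u v.
Proof. by split=> [/eqP/word_eqP|uv]; [|exact/eqP/word_eqP]. Qed.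

Lemma cls_repr (g : G) : cls (repr g) = g.
Proof. exact: reprK. Qed.

Lemma cls_nil : cls [::] = 1 :> G.
Proof. by []. Qed.

Lemma cls_cat u v : cls (u ++ v) = cls u * cls v :> G.
Proof. exact/esym/pmulE. Qed.

Definition gen (x : I) : G := cls [:: (x, false)].

Lemma cls_inv x : cls [:: (x, true)] = (gen x)^-1 :> G.
Proof.
apply/esym/mulg1_eq; rewrite -cls_cat -cls_nil.
exact/cls_eqP/WeqCancel.
Qed.

Lemma cls_pos_word u : cls (pos_word u) = \prod_(x <- u) gen x :> G.
Proof.
elim: u => [|x u IH]; first by rewrite big_nil.
by rewrite big_cons -IH -cls_cat.
Qed.

Lemma gen_rel u v : rel u v -> \prod_(x <- u) gen x = \prod_(x <- v) gen x :> G.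
Proof. by move=> uv; rewrite -!cls_pos_word; exact/cls_eqP/WeqRel. Qed.

Lemma presented_ind (T : G -> Prop) : T 1 ->
  (forall g x, T g -> T (g * gen x)) ->
  (forall g x, T g -> T (g * (gen x)^-1)) -> forall g, T g.
Proof.
move=> T1 Tg TV g; rewrite -(cls_repr g); move: (repr g) => w {g}.
elim/last_ind: w => // w [x [|]] IH; rewrite -cats1 cls_cat.
  by rewrite cls_inv; exact: TV.
exact: Tg.
Qed.

(** * Homomorphisms out of a presented group *)

Section Lift.

Variables (H : groupType) (f : I -> H).
Hypothesis f_rel : forall u v, rel u v ->
  \prod_(x <- u) f x = \prod_(x <- v) f x.

Let letter (a : I * bool) : H := if a.2 then (f a.1)^-1 else f a.1.

Definition lift_hom (g : G) : H := \prod_(a <- repr g) letter a.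

Lemma lift_cls w : lift_hom (cls w) = \prod_(a <- w) letter a.
Proof.
have pos_elt u : \prod_(a <- pos_word u) letter a = \prod_(x <- u) f x.
  by rewrite big_map.
suff: forall u v, word_eq rel u v ->
    \prod_(a <- u) letter a = \prod_(a <- v) letter a.
  by apply; apply/cls_eqP; rewrite cls_repr.
move=> u v; elim=> {u v} [//|u v _ ->//|u v z _ -> _ ->//||x b|u v uv].
- by move=> u u' v v' _ IH1 _ IH2; rewrite !big_cat /= IH1 IH2.
- rewrite !big_cons !big_nil mulg1 /letter /=.
  by case: b => /=; [exact: mulVg|exact: mulgV].
- by rewrite !pos_elt; exact: f_rel.
Qed.

Lemma liftM g h : lift_hom (g * h) = lift_hom g * lift_hom h.
Proof.
by rewrite -{1}(cls_repr g) -{1}(cls_repr h) -cls_cat lift_cls big_cat.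
Qed.

Lemma lift_gen x : lift_hom (gen x) = f x.
Proof. by rewrite lift_cls big_seq1. Qed.

End Lift.

Section Weight.

Variable f : I -> int.
Hypothesis f_rel : forall u v, rel u v ->
  (\sum_(x <- u) f x = \sum_(x <- v) f x)%R.

Let letter (a : I * bool) : int := if a.2 then (- f a.1)%R else f a.1.

(** The analogue of [lift_hom] with values in the additive group of integers. *)
Definition weight (g : G) : int := (\sum_(a <- repr g) letter a)%R.

Lemma weight_cls w : weight (cls w) = (\sum_(a <- w) letter a)%R.
Proof.
have pos_elt u : (\sum_(a <- pos_word u) letter a = \sum_(x <- u) f x)%R.
  by rewrite big_map.
suff: forall u v, word_eq rel u v ->
    (\sum_(a <- u) letter a = \sum_(a <- v) letter a)%R.
  by apply; apply/cls_eqP; rewrite cls_repr.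
move=> u v; elim=> {u v} [//|u v _ ->//|u v z _ -> _ ->//||x b|u v uv].
- by move=> u u' v v' _ IH1 _ IH2; rewrite !big_cat /= IH1 IH2.
- rewrite !big_cons !big_nil GRing.addr0 /letter /=.
  by case: b => /=; [exact: GRing.addNr|exact: GRing.addrN].
- by rewrite !pos_elt; exact: f_rel.
Qed.

Lemma weightM g h : weight (g * h) = (weight g + weight h)%R.
Proof.
by rewrite -{1}(cls_repr g) -{1}(cls_repr h) -cls_cat weight_cls big_cat.
Qed.

Lemma weight_pos u : weight (cls (pos_word u)) = (\sum_(x <- u) f x)%R.
Proof. by rewrite weight_cls big_map. Qed.

Lemma weight_gen x : weight (gen x) = f x.
Proof. by rewrite weight_cls big_seq1. Qed.

End Weight.

End Presented.

(** * The Artin group as a group of fractions, and its lattice order *)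

Section GarsideGroup.

Variables (I : choiceType) (m : I -> I -> nat).
Hypothesis m_sym : forall i j, m i j = m j i.
Hypothesis m_diag : forall i, m i i = 1%N.
Hypothesis cube : forall i j k, i != j -> j != k -> i != k ->
  cube_ok (m i j) (m j k) (m i k).

Local Notation peq := (peq m).
Local Notation compl := (compl m).

Variant artin_rel : seq I -> seq I -> Prop :=
  ArtinRel i j : artin_rel (i :: compl i j) (j :: compl j i).

Definition artin : groupType := presented artin_rel.

Definition pos_elt (u : seq I) : artin := cls artin_rel (pos_word u).

Lemma pos_cat u v : pos_elt (u ++ v) = pos_elt u * pos_elt v.
Proof. by rewrite /pos_elt /pos_word map_cat cls_cat. Qed.

Lemma peq_pos u v : peq u v -> pos_elt u = pos_elt v.
Proof.
elim=> // {}u {}v w [l i j s] _ <-.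
rewrite -!cat_cons !pos_cat; congr (_ * (_ * _)).
exact/cls_eqP/WeqRel/ArtinRel.
Qed.

Variable delta : seq I.
Hypothesis delta_comm : forall i, peq (i :: delta) (delta ++ [:: i]).
Hypothesis delta_div : forall i, exists w, peq (i :: w) delta.

Lemma peq_delta_comm u : peq (u ++ delta) (delta ++ u).
Proof.
elim: u => [|i u IH]; first by rewrite cats0; exact: PeqRefl.
apply: peq_trans (peq_catl [:: i] IH) _.
by have := peq_catr u (delta_comm i); rewrite -catA.
Qed.

Definition deltas n := iter n (cat delta) [::].

Lemma deltasD a b : deltas (a + b) = deltas a ++ deltas b.
Proof. by elim: a => //= a ->; rewrite catA. Qed.

Lemma peq_deltas_comm n u : peq (u ++ deltas n) (deltas n ++ u).
Proof.
elim: n => [|n IH] /=; first by rewrite cats0; exact: PeqRefl.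
rewrite catA; apply: peq_trans (peq_catr _ (peq_delta_comm u)) _.
by rewrite -!catA; exact: peq_catl.
Qed.

(* A word of the group is sent to a fraction [num w * delta ^ (- den w)],
   replacing each inverse letter [i^-1] by [i^* delta^-1]. *)
Let star : I -> seq I := fun i => proj1_sig (cid (delta_div i)).

Let starP i : peq (i :: star i) delta.
Proof. by rewrite /star; case: cid. Qed.

Let starPl i : peq (star i ++ [:: i]) delta.
Proof.
apply: (@peq_catlI _ _ m_sym m_diag cube [:: i]).
apply: peq_trans (peq_sym (delta_comm i)).
by have := peq_catr [:: i] (starP i).
Qed.

Let num (w : word I) := flatten [seq if a.2 then star a.1 else [:: a.1] | a <- w].
Let den (w : word I) := count snd w.

Let num_pos u : num (pos_word u) = u.
Proof. by elim: u => //= x u IH; rewrite -{2}IH. Qed.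

Let den_pos (u : seq I) : den (pos_word u) = 0%N.
Proof. by elim: u. Qed.

(** Equality of fractions, cross-multiplied so that it makes sense in the monoid. It survives every
    rule generating the group congruence, and on positive words it says that the monoid embeds in
    the group. *)
Lemma word_eq_fraction u v : word_eq artin_rel u v ->
  peq (num u ++ deltas (den v)) (num v ++ deltas (den u)).
Proof.
elim=> {u v}.
- by move=> u; exact: PeqRefl.
- by move=> u v _; exact: peq_sym.
- move=> u v w _ IH1 _ IH2.
  (* Transitivity: multiply by the denominator of the middle fraction, and cancel it at the end. *)
  apply: (@peq_catlI _ _ m_sym m_diag cube (deltas (den v))).
  apply: peq_trans (peq_sym (peq_deltas_comm _ _)) _.
  apply: peq_trans (peq_deltas_comm _ _).
  have sw a b c : peq (a ++ deltas b ++ deltas c) (a ++ deltas c ++ deltas b).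
    by rewrite -!deltasD addnC; exact: PeqRefl.
  rewrite -!catA; apply: peq_trans (sw _ _ _) _; rewrite catA.
  apply: peq_trans (peq_catr _ IH1) _; rewrite -catA.
  apply: peq_trans (sw _ _ _) _; rewrite catA.
  by apply: peq_trans (peq_catr _ IH2) _; rewrite -catA; exact: sw.
- move=> u u' v v' _ IH1 _ IH2; rewrite /num /den !map_cat !flatten_cat !count_cat.
  rewrite -!/(num _) -!/(den _) !deltasD.
  have sh a b c d : peq (((a ++ b) ++ deltas c) ++ deltas d)
                        ((a ++ deltas c) ++ (b ++ deltas d)).
    rewrite -!catA; apply: peq_catl; rewrite !catA; apply: peq_catr.
    exact: peq_deltas_comm.
  rewrite !catA; apply: peq_trans (sh _ _ _ _) _.
  by apply: peq_trans (peq_cat IH1 IH2) _; exact/peq_sym/sh.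
- move=> x [] /=; rewrite /num /den /= ?cats0.
  + exact: starPl.
  + exact: starP.
- move=> u v [i j]; rewrite !num_pos !den_pos !cats0.
  by have := peq_rel m i j [::]; rewrite !cats0.
Qed.

Lemma pos_inj u v : pos_elt u = pos_elt v -> peq u v.
Proof.
by move/cls_eqP/word_eq_fraction; rewrite !num_pos !den_pos !cats0.
Qed.

Definition Delta : artin := pos_elt delta.

Lemma pos_deltas n : pos_elt (deltas n) = Delta ^+ n.
Proof. by elim: n => // n IH; rewrite expgS -IH -pos_cat. Qed.

Lemma Delta_comm g : commute Delta g.
Proof.
have gen_comm x : commute Delta (gen artin_rel x).
  by rewrite /commute -!(pos_cat _ [:: x], pos_cat [:: x]); apply/esym/peq_pos/delta_comm.
elim/presented_ind: g => [|g x Hg|g x Hg]; first exact: commute1.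
- exact: commuteM.
- by apply: commuteM Hg _; exact/commuteV.
Qed.

Definition cone (g : artin) : Prop := exists u, g = pos_elt u.

Lemma cone1 : cone 1.
Proof. by exists [::]. Qed.

Lemma coneM g h : cone g -> cone h -> cone (g * h).
Proof. by move=> [u ->] [v ->]; exists (u ++ v); rewrite pos_cat. Qed.

Lemma cone_Delta : cone Delta.
Proof. by exists delta. Qed.

Lemma cone_absorb g : exists n, cone (g * Delta ^+ n).
Proof.
elim/presented_ind: g => [|g x [n gn]|g x [n gn]].
- by exists 0%N; rewrite mulg1; exact: cone1.
- exists n; rewrite -mulgA (commuteX _ (commute_sym (Delta_comm _))) mulgA.
  by apply: coneM gn _; exists [:: x].
- exists n.+1; have -> : g / gen artin_rel x * Delta ^+ n.+1 =
      g * Delta ^+ n * ((gen artin_rel x)^-1 * Delta).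
    rewrite expgSr -!mulgA; congr (_ * _); rewrite !mulgA.
    by rewrite (commuteX _ (commute_sym (Delta_comm _))).
  apply: coneM gn _; exists (star x); apply: (mulgI (gen artin_rel x)).
  by rewrite mulVKg -(pos_cat [:: x]); apply/esym/peq_pos/starP.
Qed.

Lemma deltas_div u : exists w, peq (u ++ w) (deltas (size u)).
Proof.
elim: u => [|i u [w uw]]; first by exists [::]; exact: PeqRefl.
exists (w ++ star i); rewrite catA.
apply: peq_trans (peq_catr (star i) (peq_catl [:: i] uw)) _.
rewrite -catA; apply: peq_trans (peq_catl [:: i] (peq_sym (peq_deltas_comm _ _))) _.
by rewrite /= -cat_cons; apply/peq_catr/starP.
Qed.

(** A power of the central [Delta] clears both denominators. The bound is then the right lcm of two
    positive words, which exists because both divide a power of [delta]; its universality passes to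
    the group since the monoid embeds. *)
Lemma cone_lub g h : exists x, [/\ cone (g^-1 * x), cone (h^-1 * x) &
  forall u, cone (g^-1 * u) -> cone (h^-1 * u) -> cone (x^-1 * u)].
Proof.
have [a ga] := cone_absorb g; have [b hb] := cone_absorb h.
have {ga}[u gE] : cone (g * Delta ^+ (a + b)).
  rewrite expgnDr mulgA; apply: coneM ga _.
  by exists (deltas b); rewrite pos_deltas.
have {hb}[v hE] : cone (h * Delta ^+ (a + b)).
  rewrite addnC expgnDr mulgA; apply: coneM hb _.
  by exists (deltas a); rewrite pos_deltas.
move: (a + b)%N gE hE => n {a b} gE hE.
have DC k x : x * Delta ^- k = Delta ^- k * x.
  by apply/esym/commute_sym/commuteV/commuteX/commute_sym/Delta_comm.
have {}gE : g = pos_elt u * Delta ^- n by rewrite -gE mulgK.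
have {}hE : h = pos_elt v * Delta ^- n by rewrite -hE mulgK.
have [x [y lcm_uv]] : exists x y, lcmw m u v x y.
  have [w uw] := deltas_div u; have [z vz] := deltas_div v.
  apply: (@lcmw_exists _ _ m_sym m_diag cube _ _
    (w ++ deltas (size v)) (z ++ deltas (size u))).
  rewrite !catA; apply: peq_trans (peq_catr _ uw) _.
  rewrite -deltasD addnC deltasD; apply/peq_sym; exact: peq_catr.
have quo w z : (pos_elt w * Delta ^- n)^-1 * (pos_elt (w ++ z) * Delta ^- n) = pos_elt z.
  by rewrite pos_cat invgM -!mulgA mulKg DC mulKg.
exists (pos_elt (u ++ x) * Delta ^- n); split.
- by rewrite gE quo; exists x.
- by rewrite hE (peq_pos (lcmw_peq lcm_uv)) quo; exists y.
move=> w [A wA] [B wB].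
have wgA : w = pos_elt (u ++ A) * Delta ^- n.
  by rewrite -[w](mulVKg g) wA gE pos_cat -!mulgA DC.
have wgB : w = pos_elt (v ++ B) * Delta ^- n.
  by rewrite -[w](mulVKg h) wB hE pos_cat -!mulgA DC.
have /pos_inj uAvB : pos_elt (u ++ A) = pos_elt (v ++ B).
  by apply: (mulIg (Delta ^- n)); rewrite -wgA.
have [W AW _] := lcmw_univ m_sym m_diag cube lcm_uv uAvB.
exists W; rewrite wgA (peq_pos (peq_catl u AW)) catA; exact: quo.
Qed.

End GarsideGroup.

(** * Translation numbers in a lattice-ordered group *)

Local Open Scope classical_set_scope.

Section LatticeOrderedGroup.

Variables (Q : groupType) (P : Q -> Prop) (D : Q) (wt : Q -> int).
Hypothesis P1 : P 1.
Hypothesis PM : forall g h, P g -> P h -> P (g * h).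
(** The order is g <= h iff [P (g^-1 * h)], invariant under left translation. *)
Hypothesis lub2 : forall g h, exists x, [/\ P (g^-1 * x), P (h^-1 * x) &
  forall u, P (g^-1 * u) -> P (h^-1 * u) -> P (x^-1 * u)].

Lemma lub_seq (s : nat -> Q) n : exists x,
  (forall i, (i <= n)%N -> P ((s i)^-1 * x)) /\
  forall u, (forall i, (i <= n)%N -> P ((s i)^-1 * u)) -> P (x^-1 * u).
Proof.
elim: n => [|n [x [x_ub x_lub]]].
  exists (s 0%N); split=> [i|u]; last exact.
  by rewrite leqn0 => /eqP ->; rewrite mulVg.
have [y [xy sy y_lub]] := lub2 x (s n.+1); exists y; split=> [i|u u_ub].
  rewrite leq_eqVlt => /predU1P[-> //|lt_in].
  by have := PM (x_ub i lt_in) xy; rewrite mulgA mulgK.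
by apply: y_lub; [apply: x_lub => i le_in; apply: u_ub; exact: ltnW|exact: u_ub].
Qed.

(* The conjugator [y] is the least upper bound of the [g ^+ i] for [i < N]. *)
Lemma conj_powers c g N : (forall h, commute c h) -> P c -> (0 < N)%N ->
  P (g ^+ N * c) -> exists y, forall j, (j <= N)%N -> P ((g ^+ j) ^ y * c).
Proof.
move=> c_central Pc; case: N => // N _ PN.
have [y [y_ub y_lub]] := lub_seq (fun i => g ^+ i) N.
exists y => j le_jN; rewrite conjgE -mulgA; apply: y_lub => i le_iN.
have [le_ji|lt_ij] := leqP j i.
  rewrite -{1}(subnKC le_ji) expgnDr invgM -!mulgA mulKg mulgA.
  by apply: PM Pc; apply: y_ub; exact: leq_trans (leq_subr _ _) le_iN.
(* For i < j the exponent wraps around: j - i is [N.+1] minus a number between 0 and [N]. The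
   positive element [g ^+ N.+1 * c] absorbs the first part, and the upper bound [y] the second. *)
have Ej : g ^+ j = g ^+ i * (g ^+ N.+1 * (g ^+ (N.+1 - (j - i)))^-1).
  apply: (mulIg (g ^+ (N.+1 - (j - i)))); rewrite -!mulgA mulVg mulg1 -!expgnDr.
  by congr (_ ^+ _); lia.
rewrite Ej -!mulgA mulKg -(c_central y) (mulgA _ c) -(c_central (_^-1)).
rewrite !mulgA -mulgA; apply: PM PN _; apply: y_ub; lia.
Qed.

Lemma conj_positive n g : (0 < n)%N -> P (g ^+ n) -> exists y, P (g ^ y).
Proof.
move=> n_gt0 Pn; have P1n : P (g ^+ n * 1) by rewrite mulg1.
have c1 (h : Q) : commute 1 h by apply: commute_sym; exact: commute1.
have [y /(_ 1%N n_gt0)] := conj_powers c1 P1 n_gt0 P1n.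
by rewrite expg1 mulg1; exists y.
Qed.

Hypothesis D_central : forall h, commute D h.
Hypothesis PD : P D.
Hypothesis P_absorb : forall g, exists n, P (g * D ^+ n).
Hypothesis wtM : forall g h, wt (g * h) = (wt g + wt h)%R.
Hypothesis P_finite : forall k, finite_set [set p | P p /\ (wt p <= k)%R].

Lemma wt1 : wt 1 = 0%R.
Proof. by apply: (addrI (wt 1)); rewrite -wtM mulg1 addr0. Qed.

Lemma wtV g : wt g^-1 = (- wt g)%R.
Proof. by apply: (addrI (wt g)); rewrite -wtM mulgV wt1 subrr. Qed.

Lemma wtJ g h : wt (g ^ h) = wt g.
Proof. by rewrite conjgE !wtM wtV; lia. Qed.

Lemma wtX g n : wt (g ^+ n) = (wt g *+ n)%R.
Proof. by elim: n => [|n IH]; [exact: wt1|rewrite expgS wtM IH mulrS]. Qed.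

Lemma DX_central n h : commute (D ^+ n) h.
Proof. exact/commute_sym/commuteX/commute_sym/D_central. Qed.

Lemma PX g n : P g -> P (g ^+ n).
Proof. by move=> Pg; elim: n => // n IH; rewrite expgS; exact: PM. Qed.

Lemma power_torsion : exists2 N, (0 < N)%N & forall g, wt g = 0%R ->
  P (g ^+ N * D) -> torsion g.
Proof.
have [s sE] := (finite_seqP _).1 (P_finite (wt D)).
(* [s] lists the positive elements of weight at most [wt D]; the exponents 0, ..., [(size s).+1]
   give too many of them to be distinct. *)
exists (size s).+1 => // g g0 /(conj_powers D_central PD (ltn0Sn _))[y Py].
pose t := [seq (g ^+ j) ^ y * D | j <- iota 0 (size s).+2].
have /uniqPn : ~~ uniq t.
  apply/negP => /uniq_leq_size ts; have /ts : {subset t <= s}.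
    move=> p /mapP[j]; rewrite mem_iota add0n ltnS => le_j ->.
    suff : [set` s] ((g ^+ j) ^ y * D) by [].
    rewrite -sE; split; first exact: Py.
    by rewrite wtM wtJ wtX g0 mul0rn add0r.
  by rewrite size_map size_iota ltnNge leqnSn.
move=> /(_ 1)[i [j [lt_ij]]]; rewrite size_map size_iota => lt_j.
rewrite !(nth_map 0%N) ?size_iota ?(ltn_trans lt_ij) // !nth_iota ?(ltn_trans lt_ij) //.
move=> /mulIg/conjg_inj; rewrite !add0n => gij.
exists (j - i)%N; first by rewrite subn_gt0.
by apply: (mulgI (g ^+ i)); rewrite -expgnDr subnKC ?(ltnW lt_ij) // mulg1.
Qed.

(** * Translation numbers of a group embedded in the ordered group *)

Section Translation.

Variables (R : realType) (K : groupType) (f : K -> Q) (X : set K).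
Hypothesis fM : {morph f : x y / x * y}.
Hypothesis f_inj : forall x, f x = 1 -> x = 1.
Hypothesis genX : finite_semigroup_generators X.

Lemma hom1 : f 1 = 1.
Proof. by apply: (mulgI (f 1)); rewrite -fM !mulg1. Qed.

Lemma homX g n : f (g ^+ n) = f g ^+ n.
Proof. by elim: n => [|n IH]; rewrite ?hom1 // !expgS fM IH. Qed.

Lemma homV g : f g^-1 = (f g)^-1.
Proof. by apply/esym/mulg1_eq; rewrite -fM mulgV hom1. Qed.

Lemma homJ g h : f (g ^ h) = f g ^ f h.
Proof. by rewrite !conjgE !fM homV. Qed.

Lemma hom_injective : injective f.
Proof. by move=> x y fxy; apply/divg1_eq/f_inj; rewrite fM homV fxy mulgV. Qed.

(** As [X] generates, the minimum exists and [xget] does not fall back on its default. *)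
Let word_length_spec g :
  (exists2 w, word_for X g w & size w = word_length X g) /\
  forall w, word_for X g w -> (word_length X g <= size w)%N.
Proof.
have [_ /(_ g)[w0 [_ w0g]]] := genX.
pose p := [pred n | `[< exists2 w, word_for X g w & size w = n >]].
have exp : exists n, p n by exists (size w0); apply/asboolP; exists w0.
case: (ex_minnP exp) => n /asboolP n_w n_min.
suff : [set n | (exists2 w, word_for X g w & size w = n) /\
  forall w, word_for X g w -> (n <= size w)%N] (word_length X g) by [].
apply: xgetPex; exists n; split=> // w w_g.
by apply: n_min; apply/asboolP; exists w.
Qed.

Lemma word_lengthP g : exists2 w, word_for X g w & size w = word_length X g.
Proof. by have [] := word_length_spec g. Qed.

Lemma word_length_le g w : word_for X g w -> (word_length X g <= size w)%N.
Proof. by have [_] := word_length_spec g; apply. Qed.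

Lemma word_lengthX g n : (word_length X (g ^+ n) <= n * word_length X g)%N.
Proof.
have [w [wX wg] <-] := word_lengthP g.
suff /word_length_le : word_for X (g ^+ n) (flatten (nseq n w)).
  by rewrite size_flatten /shape map_nseq sumn_nseq mulnC.
elim: n => [|n [IHX IHg]] /=; first by split=> [x|]; rewrite ?big_nil.
split=> [x|]; last by rewrite big_cat /= wg IHg expgS.
by rewrite mem_cat => /orP[/wX|/IHX].
Qed.

(** One constant serves the finitely many generators, and the bounds add up along a shortest word
    because [D] is central. *)
Lemma cone_word_bound : exists2 C, (0 < C)%N & forall g,
  P (f g * D ^+ (C * word_length X g)) /\ (`|wt (f g)| <= C * word_length X g)%N.
Proof.
have [/finite_seqP[s sE] _] := genX.
have [C C_gt0 Cs] : exists2 C, (0 < C)%N & forall x, x \in s ->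
    P (f x * D ^+ C) /\ (`|wt (f x)| <= C)%N.
  elim: (s) => [|x t [C C_gt0 IH]]; first by exists 1%N.
  have [n xn] := P_absorb (f x); exists (C + (n + `|wt (f x)|))%N; first by lia.
  move=> y; rewrite inE => /predU1P[-> |/IH[yC wC]]; split; try lia.
    by rewrite addnCA expgnDr mulgA; apply: PM xn (PX _ PD).
  by rewrite expgnDr mulgA; apply: PM yC (PX _ PD).
exists C => // g; have [w [wX <-] <-] := word_lengthP g.
have {}Cs x : x \in w -> P (f x * D ^+ C) /\ (`|wt (f x)| <= C)%N.
  by move=> /wX; rewrite sE; exact: Cs.
elim: w Cs {wX} => [|x w IH] Cs; first by rewrite big_nil hom1 muln0 wt1 mulg1.
have [xC wC] := Cs x (mem_head _ _).
have [|wxC wwC] := IH; first by move=> y yw; apply: Cs; rewrite inE yw orbT.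
rewrite big_cons fM wtM -[size (x :: w)]/(size w).+1 mulnS; split; last first.
  have absD (a b : int) c d : (`|a| <= c -> `|b| <= d -> `|(a + b)%R| <= c + d)%N by lia.
  exact: absD wC wwC.
have sw (a b : Q) i j : a * b * D ^+ (i + j) = a * D ^+ i * (b * D ^+ j).
  by rewrite expgnDr !mulgA -(mulgA a) -(DX_central i b) !mulgA.
by rewrite sw; exact: PM.
Qed.

Local Notation tr := (@translation_number R K X).
Local Notation len g n := ((word_length X (g ^+ n))%:R / n%:R : R)%R.

Lemma len_bounds g n : (0 <= len g n <= (word_length X g)%:R)%R.
Proof.
rewrite divr_ge0 ?ler0n //=; case: n => [|n]; first by rewrite invr0 mulr0 ler0n.
by rewrite ler_pdivrMr ?ltr0n // -natrM ler_nat mulnC word_lengthX.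
Qed.

Lemma tr_bounded g : bounded_fun (fun n => len g n : R^o).
Proof.
exists ((word_length X g)%:R)%R; split; first exact: num_real.
move=> x Mx n _ /=; have /andP[ge0 leM] := len_bounds g n.
by rewrite ger0_norm //; apply: le_trans leM (ltW Mx).
Qed.

(** The lower limit is the supremum of the infima of the tails. The tail from 1 on is used because
    the term at 0 is a division by zero. *)
Lemma tr_lt g rho : (tr g < rho)%R ->
  exists2 n, (0 < n)%N & ((word_length X (g ^+ n))%:R < rho * n%:R :> R)%R.
Proof.
rewrite /translation_number limn_infE; last exact: tr_bounded.
pose u n : R^o := len g n; rewrite -/u => sup_lt.
have : (infs u 1%N < rho)%R.
  apply: le_lt_trans sup_lt; apply: ub_le_sup; last by exists 1%N.
  exact/bounded_fun_has_ubound_infs/tr_bounded.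
move=> /inf_lt[|_ [n /= n_gt0 <-]]; first by exists (u 1%N), 1%N => /=.
by rewrite /u ltr_pdivrMr ?ltr0n //; exists n.
Qed.

(** Reducing exponents modulo the order bounds the lengths of all powers. *)
Lemma tr_torsion g : torsion g -> tr g = 0%R.
Proof.
move=> [k k_gt0 gk1].
have bound n : (word_length X (g ^+ n) <= k * word_length X g)%N.
  rewrite (divn_eq n k) expgnDr mulnC expgnA gk1 expg1n mul1g.
  apply: leq_trans (word_lengthX _ _) _; rewrite leq_mul2r.
  by rewrite (ltnW (ltn_pmod _ _)) ?orbT.
suff : (fun n => len g n) @ \oo --> (0 : R)%R.
  by move=> /cvg_limn_inf_sup[].
rewrite -cvg_shiftS.
apply: (@squeeze_cvgr _ _ _ _ (fun=> 0%R)
  (fun n => (k * word_length X g)%:R * harmonic n)%R).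
- near=> n; have /andP[-> _] := len_bounds g n.+1.
  by rewrite /harmonic /= ler_pM2r ?invr_gt0 ?ltr0n // ler_nat bound.
- exact: cvg_cst.
- rewrite -[X in _ --> X](mulr0 (k * word_length X g)%:R%R).
  by apply: cvgM cvg_harmonic; exact: cvg_cst.
Unshelve. all: by end_near.
Qed.

Lemma tr_gap : exists2 eps : R, (0 < eps)%R & forall g,
  (tr g < eps)%R -> torsion g.
Proof.
have [C C_gt0 CP] := cone_word_bound; have [N N_gt0 NP] := power_torsion.
(* With [L] the length of [g ^+ n], this choice yields C N L < n for some positive n. *)
exists ((C * N)%:R^-1)%R; first by rewrite invr_gt0 ltr0n muln_gt0 C_gt0.
move=> g /tr_lt[n n_gt0]; rewrite mulrC ltr_pdivlMr ?ltr0n ?muln_gt0 ?C_gt0 //.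
rewrite -natrM ltr_nat; set L := word_length X _ => ltLn.
have [PL wL] := CP (g ^+ n); rewrite -/L homX wtX in PL wL.
(* The integer |wt (f g)| times n is at most C L < n. *)
have wg : wt (f g) = 0%R.
  apply/eqP; rewrite -absz_eq0 -[_ == _]negbK -lt0n; apply/negP => wg_gt0.
  move: wL; rewrite -mulr_natr abszM leqNgt => /negP; apply.
  by rewrite natz absz_nat; nia.
(* As n >= C L N, this is the [N]-th power of the positive element [f g ^+ n * D ^+ (C * L)] times a
   power of [D]. *)
have /(conj_positive n_gt0)[y] : P ((f g ^+ N * D) ^+ n).
  rewrite expgMn; last exact/commute_sym/D_central.
  have -> : n = (C * L * N + (n - C * L * N))%N by nia.
  rewrite [X in _ * X]expgnDr mulgA; apply: PM (PX _ PD).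
  have -> : (C * L * N + (n - C * L * N))%N = n by nia.
  rewrite expgnAC [X in _ * X]expgnA -expgMn; first exact: PX.
  exact/commute_sym/DX_central.
rewrite conjMg conjXg (conjgE D) (D_central y) mulKg => /NP[|k k_gt0]; first by rewrite wtJ.
rewrite -conjXg => /eqP; rewrite conjg_eq1 -homX => /eqP/f_inj gk1.
by exists k.
Qed.

Lemma tr_le_finite (rho : R) : exists2 F : set Q, finite_set F & forall g,
  (tr g <= rho)%R -> exists y, F (f g ^ y).
Proof.
have [C C_gt0 CP] := cone_word_bound.
have [r rho_r] : exists r : nat, (rho < r%:R)%R.
  exists (Num.bound `|rho|%R).
  exact: le_lt_trans (ler_norm _) (archi_boundP (normr_ge0 _)).
(* Some [g ^+ n] has length L < r n, hence C L <= B n: so [(f g * D ^+ B) ^+ n] is positive, and the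
   same [B] bounds the weight of [f g]. *)
pose B := (C * r)%N.
exists [set p * (D ^+ B)^-1 | p in [set p | P p /\ (wt p <= B%:Z + wt D *+ B)%R]].
  by apply: finite_image; exact: P_finite.
move=> g g_rho; have [n n_gt0] := tr_lt (le_lt_trans g_rho rho_r).
rewrite -natrM ltr_nat; set L := word_length X _ => ltL.
have [PL wL] := CP (g ^+ n); rewrite -/L homX wtX in PL wL.
have wg : (wt (f g) <= B%:Z)%R.
  have : (`|wt (f g)| * n <= B * n)%N.
    by rewrite -mulr_natr abszM natz absz_nat in wL; rewrite /B; nia.
  by rewrite leq_pmul2r // => ?; lia.
have /(conj_positive n_gt0)[y] : P ((f g * D ^+ B) ^+ n).
  rewrite expgMn; last exact/commute_sym/DX_central.
  rewrite -expgnA; have -> : (B * n = C * L + (B * n - C * L))%N by rewrite /B; nia.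
  by rewrite expgnDr mulgA; apply: PM PL (PX _ PD).
rewrite conjMg (conjgE (D ^+ B)) (DX_central B y) mulKg => Py.
exists y; exists (f g ^ y * D ^+ B); last by rewrite mulgK.
by split=> //; rewrite wtM wtJ wtX lerD2r.
Qed.

Lemma translation_number_gap : (forall g, ~ torsion g -> (0 < tr g)%R) /\
  isolated (range tr) 0%R.
Proof.
have [eps eps_gt0 gap] := tr_gap; split=> [g ntg|].
  by rewrite ltNge; apply/negP => le0; apply: ntg; apply: gap; exact: le_lt_trans eps_gt0.
have tr1 : tr 1 = 0%R by apply: tr_torsion; exists 1%N.
split; first by apply/mem_set; exists 1.
exists (ball (0 : R)%R eps); first exact: nbhsx_ballx.
apply/seteqP; split=> [x [ball_x [g _ gx]]|x ->]; last first.
  by split; [exact: ballxx|exists 1].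
move: ball_x; rewrite -gx /ball /= sub0r normrN => lt_eps.
by apply: tr_torsion; apply: gap; exact: le_lt_trans (ler_norm _) lt_eps.
Qed.

(** A conjugator in [Q] is some [f k] followed by one of the finitely many [a]. Undoing [a] leaves a
    conjugate of [g] within [K] whose image lies in a finite set, and [f] is injective. *)
Lemma conjugacy_class_finite (A : set Q) (rho : R) : finite_set A ->
  (forall q, exists k a, A a /\ q = f k * a) ->
  finite_set [set conjugacy_class g | g in [set g | (tr g <= rho)%R]].
Proof.
move=> finA coset; have [F finF FP] := tr_le_finite rho.
pose E := f @^-1` [set p ^ a^-1 | p in F & a in A].
apply: (@sub_finite_set _ _ [set conjugacy_class g | g in E]).
  move=> _ [g /FP[y Fy] <-]; have [k [a [Aa yE]]] := coset y.
  exists (g ^ k).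
    by exists (f g ^ y) => //; exists a => //; rewrite yE homJ conjgM conjgK.
  apply/seteqP; split=> _ [h _ <-].
    by exists (k * h) => //; rewrite conjgM.
  by exists (k^-1 * h) => //; rewrite conjgM conjgK.
apply: finite_image; apply: finite_preimage; last exact: finite_image2.
by move=> x y _ _; exact: hom_injective.
Qed.

End Translation.

Section Discrete.

Variables (R : realType) (K : groupType) (f : K -> Q).
Hypothesis fM : {morph f : x y / x * y}.
Hypothesis f_inj : forall x, f x = 1 -> x = 1.
Hypothesis fgK : exists X : set K, finite_semigroup_generators X.

Lemma discrete_of_embedding : translation_discrete R K.
Proof.
by split; split=> // X genX; have [] := translation_number_gap R fM f_inj genX.
Qed.

Lemma strongly_discrete_of_finite_index (A : set Q) : finite_set A ->
  (forall q, exists k a, A a /\ q = f k * a) ->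
  strongly_translation_discrete R K.
Proof.
move=> finA coset; have [sepK _] := discrete_of_embedding.
split=> //; split=> // X genX rho; exact: conjugacy_class_finite coset.
Qed.

End Discrete.
End LatticeOrderedGroup.

(** Generation is phrased as an induction principle over subgroups; adjoining inverses gives
    semigroup generators. *)
Lemma finitely_generated (K : groupType) (S : seq K) (x0 : K) :
  (forall T : K -> Prop, T 1 -> (forall g h, T g -> T h -> T (g * h)) ->
    (forall g, T g -> T g^-1) -> (forall x, x \in x0 :: S -> T x) ->
    forall g, T g) ->
  exists X : set K, finite_semigroup_generators X.
Proof.
move=> genS; pose s := (x0 :: S) ++ [seq x^-1 | x <- x0 :: S].
exists [set` s]; split=> [|g]; first exact: finite_seq.
have sV x : x \in s -> x^-1 \in s.
  rewrite !mem_cat => /orP[xS|/mapP[y yS ->]]; last by rewrite invgK yS.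
  by rewrite map_f ?orbT.
have [w [wX wg]] : exists w, word_for [set` s] g w.
  apply: (genS (fun g => exists w, word_for [set` s] g w)).
  - by exists [::]; split=> //; rewrite big_nil.
  - move=> _ _ [u [uX <-]] [v [vX <-]]; exists (u ++ v).
    by split=> [x|]; rewrite ?big_cat // mem_cat => /orP[/uX|/vX].
  - move=> _ [u [uX <-]]; exists (rev [seq x^-1 | x <- u]); split.
      by move=> x; rewrite mem_rev => /mapP[y /uX ys ->]; exact: sV.
    elim: u {uX} => [|x u IH]; first by rewrite !big_nil invg1.
    by rewrite /= rev_cons -cats1 big_cat big_seq1 /= IH big_cons invgM.
  - by move=> x xS; exists [:: x]; split=> [y|]; rewrite ?big_seq1 // inE
      => /eqP ->; rewrite /= mem_cat xS.
have x0s : x0 \in s by rewrite mem_cat mem_head.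
(* The trivial prefix makes the word nonempty. *)
exists [:: x0, x0^-1 & w]; split=> //; split=> [x|].
  by rewrite !inE => /or3P[/eqP -> //|/eqP ->|/wX //]; exact: sV.
by rewrite !big_cons mulgA mulgV mul1g.
Qed.

(** * The braid groups *)

Section IntPowers.

Variable K : groupType.
Implicit Types (g : K) (i j : int).

Definition expgz g i : K :=
  match i with Posz k => g ^+ k | Negz k => g ^- k.+1 end.

Lemma expgzS g i : expgz g (i + 1)%R = expgz g i * g.
Proof.
case: i => [k|[|k]].
- have -> : (Posz k + 1)%R = Posz k.+1 by lia.
  exact: expgSr.
- have -> : (Negz 0 + 1)%R = Posz 0 by lia.
  by rewrite /= mulVg.
- have -> : (Negz k.+1 + 1)%R = Negz k by lia.
  by rewrite /= [in RHS]expgS invgM mulgVK.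
Qed.

Lemma expgzB1 g i : expgz g (i - 1)%R = expgz g i * g^-1.
Proof. by rewrite -{2}(subrK 1%R i) expgzS mulgK. Qed.

Lemma int_ind1 (T : int -> Prop) : T 0%R -> (forall i, T i -> T (i + 1)%R) ->
  (forall i, T i -> T (i - 1)%R) -> forall i, T i.
Proof.
move=> T0 TS TP; elim/int_ind => // k.
- by move=> /TS; congr T; lia.
- by move=> /TP; congr T; lia.
Qed.

Lemma expgzD g i j : expgz g (i + j)%R = expgz g i * expgz g j.
Proof.
elim/int_ind1: j => [|j IH|j IH]; first by rewrite addr0 mulg1.
- by rewrite addrA !expgzS IH mulgA.
- by rewrite addrA !expgzB1 IH mulgA.
Qed.

Lemma expgzN g i : expgz g (- i)%R = (expgz g i)^-1.
Proof. by apply/esym/mulg1_eq; rewrite -expgzD subrr. Qed.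

Lemma commute_expgz g h i : commute g h -> commute g (expgz h i).
Proof. by case: i => k gh; [exact: commuteX|exact/commuteV/commuteX]. Qed.

Lemma expgzX g k i : expgz (g ^+ k) i = expgz g (i * k%:Z)%R.
Proof.
elim/int_ind1: i => [|i IH|i IH]; first by rewrite mul0r.
- by rewrite expgzS IH mulrDl mul1r expgzD.
- by rewrite expgzB1 IH mulrBl mul1r expgzD expgzN.
Qed.

End IntPowers.

(** * The Artin group of type B and the kernel of its winding number *)

Section ArtinB.

Variable n : nat.
Hypothesis n_gt0 : (0 < n)%N.

Local Notation Q := (artin (@mBo n)).
Local Notation H := (braid_inf n.+1).

Let mo_sym (i j : 'I_n.+1) : mBo i j = mBo j i.
Proof. exact: mB_sym. Qed.

Let mo_diag (i : 'I_n.+1) : mBo i i = 1%N.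
Proof. exact: mB_diag. Qed.

Let mo_cube (i j k : 'I_n.+1) : i != j -> j != k -> i != k ->
  cube_ok (mBo i j) (mBo j k) (mBo i k).
Proof. exact: mB_cube. Qed.

Definition aB (k : nat) : Q := gen (artin_rel (@mBo n)) (inord k).

Lemma aB_far i j : (i.+1 < j)%N -> (j <= n)%N -> commute (aB j) (aB i).
Proof.
move=> lt_ij le_j; have := peq_pos (artinB_far lt_ij le_j).
by rewrite !(pos_cat _ [:: _] [:: _]).
Qed.

Lemma aB_braid i : (0 < i)%N -> (i < n)%N ->
  aB i * aB i.+1 * aB i = aB i.+1 * aB i * aB i.+1.
Proof.
move=> lt_ij le_j; have := peq_pos (artinB_braid lt_ij le_j).
by rewrite !(pos_cat _ [:: _] [:: _; _]) !(pos_cat _ [:: _] [:: _]) !mulgA.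
Qed.

Lemma aB_braid4 : aB 0 * aB 1 * aB 0 * aB 1 = aB 1 * aB 0 * aB 1 * aB 0.
Proof.
have := peq_pos (artinB_braid4 n_gt0).
rewrite !(pos_cat _ [:: _] [:: _; _; _]) !(pos_cat _ [:: _] [:: _; _]).
by rewrite !(pos_cat _ [:: _] [:: _]) !mulgA.
Qed.

Lemma weight1_rel u v : artin_rel (@mBo n) u v ->
  (\sum_(x <- u) 1%R = \sum_(x <- v) 1%R :> int)%R.
Proof. by case=> i j; rewrite !big_const_seq /= !count_predT (size_compl mo_sym). Qed.

Definition wB : Q -> int := weight (fun _ : 'I_n.+1 => 1%R).

Lemma wB_pos u : wB (pos_elt (@mBo n) u) = (size u)%:Z%R.
Proof.
rewrite /wB /pos_elt (weight_pos weight1_rel) big_const_seq count_predT.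
by elim: (size u) => //= k ->; lia.
Qed.

(** A positive element of weight i is the value of a word of length i over a finite alphabet. *)
Lemma wB_finite (k : int) :
  finite_set [set p | cone p /\ (wB p <= k)%R].
Proof.
apply: (@sub_finite_set _ _ (\bigcup_(i in `I_(`|k|.+1))
    [set pos_elt (@mBo n) t | t in [set: i.-tuple 'I_n.+1]])).
  move=> _ [[u ->]]; rewrite wB_pos => le_k; exists (size u).
    have le_abs (a : nat) : (a%:Z <= k)%R -> (a <= `|k|)%N by lia.
    by rewrite /= ltnS; exact: le_abs le_k.
  by exists (in_tuple u).
by apply: bigcup_finite => // i _; exact/finite_image/finite_finset.
Qed.

Definition zB : Q := aB 0.

Definition tB (i : int) : Q := aB 1 ^ expgz zB i.

(** Letter 0 is z, letter 1 is t_0 and letter j - 1 is s_j, hence the predecessor. *)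
Definition sB (j : sidx n.+1) : Q := aB (val j).-1.

Lemma sidx_bounds (j : sidx n.+1) : (3 <= val j <= n.+1)%N.
Proof. by case: j. Qed.

Lemma s_z_comm j : commute (sB j) zB.
Proof. by apply: aB_far; have := sidx_bounds j; lia. Qed.

Lemma s_conj_z j i : sB j ^ expgz zB i = sB j.
Proof.
by apply/conjg_fixP/commgP; apply: commute_expgz; exact: s_z_comm.
Qed.

Lemma t_shift i j : tB (i + j)%R = tB i ^ expgz zB j.
Proof. by rewrite /tB expgzD conjgM. Qed.

(** The left side is the conjugate of t_0 t_(-1) by a power of z, and the relation of length 4 says
    that z commutes with t_0 t_(-1). *)
Lemma t_conj i : tB i * tB (i - 1)%R = aB 1 * tB (- 1)%R.
Proof.
have -> : tB i * tB (i - 1)%R = (aB 1 * tB (- 1)%R) ^ expgz zB i.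
  by rewrite conjMg -t_shift addrC.
apply/conjg_fixP/commgP/commute_expgz; rewrite /commute /tB /= conjgE.
rewrite expg1 invgK !mulgA mulgVK; have := aB_braid4.
by rewrite -/zB => ->; rewrite mulgK.
Qed.

(** Over an arbitrary alphabet, to serve both braid groups. Conjugation by a power of z fixes the
    s_j and reduces the mixed relations to t_0. *)
Lemma ts_rel_prod (I : Type) (t' : int -> I) (s' : sidx n.+1 -> I) (F : I -> Q) :
  (forall i, F (t' i) = tB i) -> (forall j, F (s' j) = sB j) ->
  forall u v, ts_rel t' s' u v -> \prod_(x <- u) F x = \prod_(x <- v) F x.
Proof.
move=> Ft Fs u v.
case=> [j k far|j k jk|i j|i j j3|i j j4]; rewrite !big_cons !big_nil ?Ft ?Fs !mulg1.
- have /orP[lt|lt] : ((val j).+1 < val k)%N || ((val k).+1 < val j)%N by lia.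
    apply: commute_sym; apply: aB_far; have := sidx_bounds j; have := sidx_bounds k; lia.
  by apply: aB_far; have := sidx_bounds j; have := sidx_bounds k; lia.
- have Ek : (val k).-1 = (val j).-1.+1 by have := sidx_bounds j; lia.
  rewrite /sB Ek !mulgA; apply: aB_braid; have := sidx_bounds j; have := sidx_bounds k; lia.
- by rewrite !t_conj.
- rewrite -(s_conj_z j i) /tB -!conjMg !mulgA; congr (_ ^ _).
  by rewrite /sB j3; apply/esym/aB_braid; have := sidx_bounds j; lia.
- rewrite -(s_conj_z j i) /tB -!conjMg; congr (_ ^ _).
  by apply: aB_far; have := sidx_bounds j; lia.
Qed.

Definition H_letter (x : gen_inf n.+1) : Q :=
  match x with InfT i => tB i | InfS j => sB j end.

Definition embH : H -> Q := lift_hom H_letter.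

Lemma H_letter_rel u v : ts_rel (@InfT n.+1) (@InfS n.+1) u v ->
  \prod_(x <- u) H_letter x = \prod_(x <- v) H_letter x.
Proof. exact: ts_rel_prod. Qed.

Lemma embHM : {morph embH : g h / g * h}.
Proof. by move=> g h; apply: liftM; exact: H_letter_rel. Qed.

Lemma embH_gen x : embH (gen _ x) = H_letter x.
Proof. by apply: lift_gen; exact: H_letter_rel. Qed.

Definition z_count (i : 'I_n.+1) : int := (i == 0%N :> nat)%:Z.

Definition wind : Q -> int := weight z_count.

(* [Q] is the semidirect product of [H] by the shift [t_i -> t_(i-1)], the
   action of [zB]: [psi k w] is the [H]-component of the word [w] read after
   [zB ^+ k]. *)
Definition H_of_letter (k : int) (i : 'I_n.+1) : H :=
  if i == 1%N :> nat then gen _ (InfT n.+1 (- k)%R)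
  else if insub (i.+1 : nat) is Some j then gen _ (@InfS n.+1 j) else 1.

Definition z_letter (a : 'I_n.+1 * bool) : int :=
  if a.2 then (- z_count a.1)%R else z_count a.1.

Fixpoint psi (k : int) (w : seq ('I_n.+1 * bool)) : H :=
  if w is a :: w' then
    (if a.1 == 0%N :> nat then 1
     else if a.2 then (H_of_letter k a.1)^-1 else H_of_letter k a.1)
    * psi (k + z_letter a)%R w'
  else 1.

Lemma psi_cat k u v : psi k (u ++ v) =
  psi k u * psi (k + \sum_(a <- u) z_letter a)%R v.
Proof.
elim: u k => [|a u IH] k /=; first by rewrite big_nil addr0 mul1g.
by rewrite IH big_cons addrA mulgA.
Qed.

Let hT (i : int) : H := gen _ (InfT n.+1 i).
Let hS (j : sidx n.+1) : H := gen _ (InfS j).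

Lemma H_of_letter_s k (i : 'I_n.+1) : (1 < i)%N ->
  exists2 j : sidx n.+1, val j = i.+1 & H_of_letter k i = hS j.
Proof.
move=> gt1; rewrite /H_of_letter; have /negbTE -> : (i != 1 :> nat)%N by lia.
by case: insubP => [j _ ji|/negP[]]; [exists j|have := ltn_ord i; lia].
Qed.

Lemma H_rel u v : ts_rel (@InfT n.+1) (@InfS n.+1) u v ->
  \prod_(x <- u) gen (ts_rel (@InfT n.+1) (@InfS n.+1)) x = \prod_(x <- v) gen _ x.
Proof. exact: gen_rel. Qed.

Lemma psi_rel k u v : artin_rel (@mBo n) u v ->
  psi k (pos_word u) = psi k (pos_word v).
Proof.
suff suf (i j : 'I_n.+1) : (i < j)%N ->
    psi k (pos_word (i :: compl (@mBo n) i j)) =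
    psi k (pos_word (j :: compl (@mBo n) j i)).
  by case=> i j; case: (ltngtP i j) => [/suf //|/suf //|/val_inj ->].
move=> lt_ij; have := ltn_ord j; rewrite ltnS => le_j.
rewrite /compl /mBo (mB_sym j) /mB.
have /negbTE -> : (i : nat) != j by lia.
have /negbTE -> : (j.+1 : nat) != i by lia.
have /negbTE j0 : (j : nat) != 0%N by lia.
rewrite j0 !orbF /=.
have [Ej|nj] := eqVneq i.+1 (j : nat); last first.
  have gt1 : (1 < j)%N by lia.
  rewrite /= /z_letter /z_count /= j0 addr0 !mulg1.
  have [i0|i0] := eqVneq (i : nat) 0%N.
    rewrite /=.
    have [j1 Ej1 ->] := H_of_letter_s (k + 1%R)%R gt1.
    have [j2 Ej2 ->] := H_of_letter_s k gt1.
    rewrite mul1g mulg1; congr hS; apply: val_inj; by rewrite Ej1.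
  rewrite addr0; have [j1 Ej1 ->] := H_of_letter_s k gt1.
  have [i1|i1] := eqVneq (i : nat) 1%N.
    rewrite /H_of_letter i1 /=.
    have le4 : (4 <= val j1)%N by lia.
    have := H_rel (RelTS _ _ (- k)%R le4).
    by rewrite !big_cons !big_nil !mulg1.
  have gti : (1 < i)%N by lia.
  have [i1' Ei1 ->] := H_of_letter_s k gti.
  have far : (2 <= `|(val i1')%:Z - (val j1)%:Z|)%R by lia.
  have := H_rel (RelComm _ _ far).
  by rewrite !big_cons !big_nil !mulg1.
have [i0|i0] := eqVneq (i : nat) 0%N.
  have j1 : (j : nat) = 1%N by lia.
  rewrite /= /z_letter /z_count /= i0 j1 /= !addr0 !mul1g !mulg1 /H_of_letter j1 /=.
  (* Read after [zB ^+ k], the word z t z t gives t_(-k-1) t_(-k-2), and t z t z gives t_(-k)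
     t_(-k-1). *)
  have := H_rel (RelTT _ _ (- (k + 1))%R (- k)%R).
  rewrite !big_cons !big_nil !mulg1.
  have -> : (- (k + 1) - 1 = - (k + 1 + 1))%R by lia.
  by have -> : (- k - 1 = - (k + 1))%R by lia.
rewrite /= /z_letter /z_count /= j0 (negbTE i0) !addr0 !mulg1.
have gt1 : (1 < j)%N by lia.
have [j1 Ej1 ->] := H_of_letter_s k gt1.
have [i1|i1] := eqVneq (i : nat) 1%N.
  rewrite /H_of_letter i1 /=.
  have j3 : val j1 = 3 by lia.
  have := H_rel (RelTS3 _ _ (- k)%R j3).
  by rewrite !big_cons !big_nil !mulg1.
have gti : (1 < i)%N by lia.
have [i1' Ei1 ->] := H_of_letter_s k gti.
have ji : val j1 = (val i1').+1 by lia.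
have := H_rel (RelBraid _ _ ji).
by rewrite !big_cons !big_nil !mulg1.
Qed.

Lemma wind_rel u v : artin_rel (@mBo n) u v ->
  (\sum_(x <- u) z_count x = \sum_(x <- v) z_count x)%R.
Proof.
case=> i j; rewrite /compl [mBo j i]mB_sym /mBo /mB.
case: ifP => [/eqP/val_inj -> //|nij].
case: ifP => _; last by rewrite /= !big_cons !big_nil; lia.
case: ifP => ij0; first by rewrite /= !big_cons !big_nil; lia.
rewrite /= !big_cons !big_nil /z_count.
by move/negbT: ij0; rewrite negb_or => /andP[/negbTE -> /negbTE ->].
Qed.

Lemma windM g h : wind (g * h) = (wind g + wind h)%R.
Proof. exact: weightM wind_rel _ _. Qed.

(** All [k] are treated at once: in a concatenation the second factor is read from a position
    shifted by the winding number of the first. *)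
Lemma psi_word_eq u v : word_eq (artin_rel (@mBo n)) u v ->
  forall k, psi k u = psi k v.
Proof.
elim=> {u v} [//|u v _ IH k|u v w _ IH1 _ IH2 k||x b k|u v uv k].
- by rewrite IH.
- by rewrite IH1.
- move=> u u' v v' uu' IH1 _ IH2 k; rewrite !psi_cat IH1 IH2.
  suff -> : (\sum_(a <- u) z_letter a = \sum_(a <- u') z_letter a)%R by [].
  rewrite -!(weight_cls wind_rel); congr weight; exact/cls_eqP.
- rewrite /= /z_letter /z_count mulg1; case: eqP => [_|_]; first by rewrite mul1g.
  case: b; rewrite /= ?oppr0 addr0; [exact: mulVg|exact: mulgV].
- exact: psi_rel.
Qed.

Definition psiQ (k : int) (q : Q) : H := psi k (repr q).

Lemma psiQ_cls k w : psiQ k (cls _ w) = psi k w.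
Proof. by apply: psi_word_eq; apply/cls_eqP; rewrite cls_repr. Qed.

Lemma psiQM k p q : psiQ k (p * q) = psiQ k p * psiQ (k + wind p)%R q.
Proof.
by rewrite -{1}(cls_repr p) -{1}(cls_repr q) -cls_cat psiQ_cls psi_cat.
Qed.

Lemma psiQ1 k : psiQ k 1 = 1.
Proof. by rewrite -[1]/(cls _ [::]) psiQ_cls. Qed.

Lemma wind1 : wind 1 = 0%R.
Proof. by apply: (addrI (wind 1)); rewrite -windM mulg1 addr0. Qed.

Lemma windV g : wind g^-1 = (- wind g)%R.
Proof. by apply: (addrI (wind g)); rewrite -windM mulgV wind1 subrr. Qed.

Lemma wind_z i : wind (expgz zB i) = i.
Proof.
have wz : wind zB = 1%R by rewrite /wind /zB /aB (weight_gen wind_rel) /z_count inordK.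
elim/int_ind1: i => [|i IH|i IH]; first exact: wind1.
- by rewrite expgzS windM IH wz.
- by rewrite expgzB1 windM IH windV wz.
Qed.

Lemma psiQ_z k i : psiQ k (expgz zB i) = 1.
Proof.
have pz j : psiQ j zB = 1 by rewrite psiQ_cls /= inordK // mulg1.
have pzV j : psiQ j zB^-1 = 1.
  have := psiQ1 (j - 1)%R; rewrite -(mulgV zB) psiQM pz mul1g.
  by rewrite -[zB]/(expgz zB 1) wind_z subrK.
elim/int_ind1: i => [|i IH|i IH]; first exact: psiQ1.
- by rewrite expgzS psiQM IH pz mulg1.
- by rewrite expgzB1 psiQM IH pzV mulg1.
Qed.

Lemma aB1_val : (inord 1 : 'I_n.+1) = 1%N :> nat.
Proof. by rewrite inordK. Qed.

Lemma psiQ_t i : psiQ 0 (tB i) = hT i.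
Proof.
rewrite /tB conjgE -expgzN psiQM psiQ_z mul1g wind_z add0r psiQM psiQ_z mulg1.
by rewrite psiQ_cls /= /H_of_letter aB1_val /= mulg1 opprK.
Qed.

Lemma wind_aB k : (0 < k)%N -> (k <= n)%N -> wind (aB k) = 0%R.
Proof. by move=> k0 kn; rewrite /wind (weight_gen wind_rel) /z_count inordK // eqn0Ngt k0. Qed.

Lemma wind_t i : wind (tB i) = 0%R.
Proof. by rewrite /tB conjgE !windM windV wind_aB //; lia. Qed.

Lemma wind_s j : wind (sB j) = 0%R.
Proof. by apply: wind_aB; have := sidx_bounds j; lia. Qed.

Lemma psiQ_s j : psiQ 0 (sB j) = hS j.
Proof.
have jb := sidx_bounds j.
have Ej : (inord (val j).-1 : 'I_n.+1) = (val j).-1 :> nat by rewrite inordK //; lia.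
have gt1 : (1 < (inord (val j).-1 : 'I_n.+1))%N by rewrite Ej; lia.
rewrite psiQ_cls /= -/(val j) gtn_eqF ?(ltnW gt1) // mulg1.
have [j' Ej' ->] := H_of_letter_s 0 gt1.
by congr hS; apply: val_inj; rewrite Ej' Ej; lia.
Qed.

(** [psiQ] is a crossed homomorphism, multiplicative at 0 on elements of winding number 0; there it
    inverts [embH] on generators, hence everywhere. *)
Lemma embH_psi h : wind (embH h) = 0%R /\ psiQ 0 (embH h) = h.
Proof.
have gens x : wind (H_letter x) = 0%R /\ psiQ 0 (H_letter x) = gen _ x.
  case: x => [i|j] /=; first by rewrite wind_t psiQ_t.
  by rewrite wind_s psiQ_s.
have gensV x : psiQ 0 (H_letter x)^-1 = (gen _ x)^-1.
  have [wx px] := gens x; apply/esym/mulg1_eq; rewrite -px.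
  by have := psiQ1 0; rewrite -{1}(mulgV (H_letter x)) psiQM wx addr0.
have embHV x : embH (gen _ x)^-1 = (H_letter x)^-1.
  by rewrite (homV embHM) embH_gen.
elim/presented_ind: h => [|h x [wh ph]|h x [wh ph]].
- by rewrite (hom1 embHM) wind1 psiQ1.
- have [wx px] := gens x.
  by rewrite embHM embH_gen windM wh wx psiQM wh addr0 ph px.
- have [wx px] := gens x.
  by rewrite embHM embHV windM windV wh wx oppr0 addr0 psiQM wh addr0 ph gensV.
Qed.

Lemma embH_inj h : embH h = 1 -> h = 1.
Proof. by have [_ {2}<- ->] := embH_psi h; exact: psiQ1. Qed.

(** Powers of z move to the right, past the s_j unchanged and past t_0 by turning it into another
    t_i. *)
Lemma Q_decomp (q : Q) : exists h i, q = embH h * expgz zB i.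
Proof.
have zt i : expgz zB i * aB 1 = tB (- i)%R * expgz zB i.
  by rewrite /tB conjgE expgzN invgK -!mulgA mulVg mulg1.
have artin_step i (x : 'I_n.+1) : (x != 0%N :> nat)%N ->
    exists h, expgz zB i * gen _ x = embH h * expgz zB i.
  move=> x0; have [x1|x1] := eqVneq (x : nat) 1%N.
    exists (hT (- i)%R); rewrite embH_gen /= -zt /aB; congr (_ * gen _ _).
    by apply: val_inj; rewrite /= inordK.
  have [|j Ej _] := @H_of_letter_s 0 x; first by lia.
  exists (hS j); rewrite embH_gen /= (commute_expgz _ (s_z_comm j)).
  by rewrite /sB Ej /aB inord_val.
elim/presented_ind: q => [|q x [h [i ->]]|q x [h [i ->]]].
- by exists 1, 0%R; rewrite (hom1 embHM) mulg1.
- have [x0|/(artin_step i)[h' Eh']] := eqVneq (x : nat) 0%N.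
    exists h, (i + 1)%R; rewrite expgzS mulgA; congr (_ * gen _ _).
    by apply: val_inj; rewrite /= inordK.
  by exists (h * h'), i; rewrite -mulgA Eh' mulgA embHM.
- have [x0|/(artin_step i)[h' Eh']] := eqVneq (x : nat) 0%N.
    exists h, (i - 1)%R; rewrite expgzB1 mulgA; congr (_ * (gen _ _)^-1).
    by apply: val_inj; rewrite /= inordK.
  exists (h * h'^-1), i; rewrite embHM (homV embHM) -!mulgA; congr (_ * _).
  by apply: (mulgI (embH h')); rewrite mulVKg mulgA -Eh' mulgK.
Qed.

Lemma discrete_of_embedding_Q (R : realType) (K : groupType) (f : K -> Q) :
  {morph f : x y / x * y} -> (forall x, f x = 1 -> x = 1) ->
  (exists X : set K, finite_semigroup_generators X) ->
  translation_discrete R K.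
Proof.
apply: (discrete_of_embedding (@cone1 _ _) (@coneM _ _)
  (cone_lub mo_sym mo_diag mo_cube (@deltaB_comm n) (@deltaB_divl n))
  (Delta_comm (@deltaB_comm n)) (cone_Delta _ _)
  (cone_absorb (@deltaB_comm n) (@deltaB_divl n)) _ wB_finite).
exact: weightM weight1_rel.
Qed.

Lemma strongly_discrete_of_finite_index_Q (R : realType) (K : groupType)
    (f : K -> Q) (A : set Q) :
  {morph f : x y / x * y} -> (forall x, f x = 1 -> x = 1) ->
  (exists X : set K, finite_semigroup_generators X) -> finite_set A ->
  (forall q, exists k a, A a /\ q = f k * a) ->
  strongly_translation_discrete R K.
Proof.
move=> fM f_inj fgK finA.
apply: (strongly_discrete_of_finite_index (@cone1 _ _) (@coneM _ _)
  (cone_lub mo_sym mo_diag mo_cube (@deltaB_comm n) (@deltaB_divl n))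
  (Delta_comm (@deltaB_comm n)) (cone_Delta _ _)
  (cone_absorb (@deltaB_comm n) (@deltaB_divl n)) _ wB_finite R fM f_inj fgK finA).
exact: weightM weight1_rel.
Qed.

(** Since t_(i+1) t_i does not depend on i, all t_i are reached from t_0 and t_1 by steps up and
    down. [S] holds further generators, such as z. *)
Lemma finitely_generated_ts (K : groupType) (tK : int -> K)
    (sK : sidx n.+1 -> K) (S : seq K) :
  (forall i j, tK i * tK (i - 1)%R = tK j * tK (j - 1)%R) ->
  (forall T : K -> Prop, T 1 -> (forall g h, T g -> T h -> T (g * h)) ->
    (forall g, T g -> T g^-1) -> (forall i, T (tK i)) -> (forall j, T (sK j)) ->
    (forall x, x \in S -> T x) -> forall g, T g) ->
  exists X : set K, finite_semigroup_generators X.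
Proof.
move=> tt genS.
(* [insub] retains from 0, ..., [n.+1] the indices of the s_j, as r is [n.+1]. *)
apply: (@finitely_generated K (tK 0%R :: [seq sK j | j <- pmap insub (iota 0 n.+2)] ++ S)
  (tK 1%R)) => T T1 TM TV TS.
have T0 : T (tK 0%R) by apply: TS; rewrite !inE eqxx orbT.
have T1' : T (tK 1%R) by apply: TS; rewrite mem_head.
apply: genS => // [i|j|x xS]; last by apply: TS; rewrite !inE mem_cat xS !orbT.
  elim/int_ind1: i => // i Ti.
    have -> : tK (i + 1)%R = tK 1%R * tK 0%R * (tK i)^-1.
      by have := tt (i + 1)%R 1%R; rewrite addrK subrr => <-; rewrite mulgK.
    exact: (TM _ _ (TM _ _ T1' T0) (TV _ Ti)).
  have -> : tK (i - 1)%R = (tK i)^-1 * (tK 1%R * tK 0%R).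
    by have := tt i 1%R; rewrite subrr => <-; rewrite mulKg.
  exact: (TM _ _ (TV _ Ti) (TM _ _ T1' T0)).
apply: TS; rewrite !inE mem_cat; do 2 (apply/orP; right); apply/orP; left.
apply/mapP; exists j => //; rewrite mem_pmap_sub mem_iota add0n ltnS.
by case/andP: (sidx_bounds j).
Qed.

Lemma H_finitely_generated : exists X : set H, finite_semigroup_generators X.
Proof.
apply: (@finitely_generated_ts H hT hS [::]).
  by move=> i j; have := H_rel (RelTT _ _ i j); rewrite !big_cons !big_nil !mulg1.
move=> T T1 TM TV Tt Ts _; have Tg x : T (gen _ x).
  by case: x => [i|j]; [exact: Tt|exact: Ts].
by elim/presented_ind => // g x Tgx; apply: TM => //; exact: TV.
Qed.

(** * The embedding of B(de,e,r) with finite index *)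

Section FiniteIndex.

Variables d e : nat.
Hypothesis e_gt0 : (0 < e)%N.

Local Notation G := (braid d e n.+1).
Local Notation g_ := (gen (@zts_rel n.+1 e)).

Definition G_letter (x : gen_fin n.+1) : Q :=
  match x with FinZ => zB ^+ e | FinT i => tB i | FinS j => sB j end.

Lemma G_letter_rel u v : zts_rel e u v ->
  \prod_(x <- u) G_letter x = \prod_(x <- v) G_letter x.
Proof.
case=> [{}u {}v|i|j]; first exact: ts_rel_prod.
- rewrite !big_cons !big_nil !mulg1 /= t_shift -[zB ^+ e]/(expgz zB e%:Z%R).
  by rewrite expgzN conjgE invgK -!mulgA mulVg mulg1.
- rewrite !big_cons !big_nil !mulg1 /=.
  exact/commute_sym/commuteX/s_z_comm.
Qed.

Definition embG : G -> Q := lift_hom G_letter.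

Lemma embGM : {morph embG : g h / g * h}.
Proof. by move=> g h; apply: liftM; exact: G_letter_rel. Qed.

Lemma embG_gen x : embG (g_ x) = G_letter x.
Proof. by apply: lift_gen; exact: G_letter_rel. Qed.

Definition HG_letter (x : gen_inf n.+1) : G :=
  match x with InfT i => g_ (FinT _ i) | InfS j => g_ (FinS j) end.

Lemma HG_letter_rel u v : ts_rel (@InfT n.+1) (@InfS n.+1) u v ->
  \prod_(x <- u) HG_letter x = \prod_(x <- v) HG_letter x.
Proof.
have G_rel a b : ts_rel (@FinT n.+1) (@FinS n.+1) a b ->
    \prod_(x <- a) g_ x = \prod_(x <- b) g_ x.
  by move=> ab; exact/gen_rel/RelNoZ.
case=> [j k far|j k jk|i j|i j j3|i j j4].
- by have := G_rel _ _ (RelComm _ _ far); rewrite !big_cons !big_nil.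
- by have := G_rel _ _ (RelBraid _ _ jk); rewrite !big_cons !big_nil.
- by have := G_rel _ _ (RelTT _ _ i j); rewrite !big_cons !big_nil.
- by have := G_rel _ _ (RelTS3 _ _ i j3); rewrite !big_cons !big_nil.
- by have := G_rel _ _ (RelTS _ _ i j4); rewrite !big_cons !big_nil.
Qed.

Definition HG : H -> G := lift_hom HG_letter.

Lemma HGM : {morph HG : g h / g * h}.
Proof. by move=> g h; apply: liftM; exact: HG_letter_rel. Qed.

Lemma HG_gen x : HG (gen _ x) = HG_letter x.
Proof. by apply: lift_gen; exact: HG_letter_rel. Qed.

Lemma embG_HG h : embG (HG h) = embH h.
Proof.
have gens x : embG (HG_letter x) = H_letter x by case: x => ?; rewrite embG_gen.
elim/presented_ind: h => [|h x IH|h x IH].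
- by rewrite (hom1 HGM) (hom1 embGM) (hom1 embHM).
- by rewrite HGM embGM embHM IH HG_gen gens embH_gen.
- rewrite HGM embGM embHM IH (homV HGM) (homV embGM) (homV embHM).
  by rewrite HG_gen gens embH_gen.
Qed.

Let zG : G := g_ (FinZ _).

Lemma embG_z i : embG (expgz zG i) = expgz zB (i * e%:Z)%R.
Proof.
rewrite -expgzX; case: i => k /=; first by rewrite (homX embGM) embG_gen.
by rewrite (homV embGM) (homX embGM) embG_gen.
Qed.

Lemma G_decomp (g : G) : exists h i, g = HG h * expgz zG i.
Proof.
have zt1 i : zG * g_ (FinT _ i) = g_ (FinT _ (i - e%:Z)%R) * zG.
  have := gen_rel (RelZT n.+1 e i); by rewrite !big_cons !big_nil !mulg1.
have zt i k : expgz zG k * g_ (FinT _ i) = g_ (FinT _ (i - k * e%:Z)%R) * expgz zG k.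
  elim/int_ind1: k i => [|k IH|k IH] i.
  - by rewrite mul0r subr0 mulg1 mul1g.
  - rewrite expgzS -mulgA zt1 mulgA IH -mulgA; congr (g_ (FinT _ _) * _); lia.
  - have := zt1 (i + e%:Z)%R; rewrite addrK => zt2.
    rewrite expgzB1 -mulgA; apply: (mulIg zG); rewrite -!mulgA mulVg mulg1.
    have -> : zG^-1 * (g_ (FinT _ i) * zG) = g_ (FinT _ (i + e%:Z)%R).
      by rewrite -zt2 mulKg.
    rewrite IH; congr (g_ (FinT _ _) * _); lia.
have zs j k : expgz zG k * g_ (FinS j) = g_ (FinS j) * expgz zG k.
  apply/commute_sym/commute_expgz/commute_sym.
  by have := gen_rel (RelZS e j); rewrite !big_cons !big_nil !mulg1.
have artin_step i x : x <> FinZ _ -> exists h, expgz zG i * g_ x = HG h * expgz zG i.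
  case: x => [//|k|j] _.
    by exists (hT (k - i * e%:Z)%R); rewrite HG_gen zt.
  by exists (hS j); rewrite HG_gen zs.
elim/presented_ind: g => [|g x [h [i ->]]|g x [h [i ->]]].
- by exists 1, 0%R; rewrite (hom1 HGM) mulg1.
- have [->|/(artin_step i)[h' Eh']] := pselect (x = FinZ _).
    by exists h, (i + 1)%R; rewrite expgzS mulgA.
  by exists (h * h'), i; rewrite -mulgA Eh' mulgA HGM.
- have [->|/(artin_step i)[h' Eh']] := pselect (x = FinZ _).
    by exists h, (i - 1)%R; rewrite expgzB1 mulgA.
  exists (h * h'^-1), i; rewrite HGM (homV HGM) -!mulgA; congr (_ * _).
  by apply: (mulgI (HG h')); rewrite mulVKg mulgA -Eh' mulgK.
Qed.

(** In the decomposition of [g], the image has winding number i e, so i = 0 and injectivity of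
    [embH] concludes. *)
Lemma embG_inj g : embG g = 1 -> g = 1.
Proof.
have [h [i ->]] := G_decomp g; rewrite embGM embG_HG embG_z => hz1.
have i0 : i = 0%R.
  have := congr1 wind hz1; rewrite windM wind_z wind1 (embH_psi h).1 add0r.
  by move/eqP; rewrite mulf_eq0 => /orP[/eqP//|]; lia.
move: hz1; rewrite i0 mul0r !mulg1 => /embH_inj ->.
by rewrite (hom1 HGM).
Qed.

(** Division with remainder by [e] of the exponent of z: z^e lies in the image, and the remainder
    selects the coset. *)
Lemma embG_coset (q : Q) :
  exists k a, [set zB ^+ c | c in `I_e] a /\ q = embG k * a.
Proof.
have [h [i ->]] := Q_decomp q.
have e0 : (e%:Z != 0)%R by lia.
have rem_ge0 := modz_ge0 i e0; have rem_lt := ltz_pmod i (_ : (0 < e%:Z)%R).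
exists (HG h * expgz zG (i %/ e)%Z), (zB ^+ `|(i %% e)%Z|); split.
  by exists `|(i %% e)%Z|%N => //=; have := rem_lt e_gt0; lia.
rewrite embGM embG_HG embG_z -mulgA; congr (_ * _).
rewrite {1}(divz_eq i e) expgzD; congr (_ * _).
by rewrite -{1}(gez0_abs rem_ge0).
Qed.

Lemma G_finitely_generated : exists X : set G, finite_semigroup_generators X.
Proof.
apply: (@finitely_generated_ts G (g_ \o @FinT _) (g_ \o @FinS _) [:: zG]).
  move=> i j; have := gen_rel (RelNoZ e (RelTT (@FinT n.+1) (@FinS n.+1) i j)).
  by rewrite !big_cons !big_nil !mulg1.
move=> T T1 TM TV Tt Ts Tz; have Tg x : T (g_ x).
  by case: x => [|i|j]; [apply: Tz; exact: mem_head|exact: Tt|exact: Ts].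
by elim/presented_ind => // g x Tgx; apply: TM => //; exact: TV.
Qed.

End FiniteIndex.

End ArtinB.

Theorem theorem4p10 (R : realType) (d e r : nat)
    (hd : 2 <= d) (hr : 2 <= r) (he : 1 <= e) :
  translation_discrete R (braid_inf r) /\
  strongly_translation_discrete R (braid d e r).
Proof.
(* With r = [n.+1], the letters 0, ..., n are those of type B_r, and r >= 2 becomes n > 0. *)
case: r hr => [//|n] n_gt0; split.
- exact: (discrete_of_embedding_Q n_gt0 R (embHM n_gt0) (@embH_inj _ n_gt0)
    (H_finitely_generated n)).
- apply: (strongly_discrete_of_finite_index_Q n_gt0 R
    (@embGM _ n_gt0 d e) (@embG_inj _ n_gt0 d e he)
    (G_finitely_generated n d e) _ (embG_coset n_gt0 d he)).
  exact/finite_image/finite_II.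
Qed.
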